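(* Assume that $g$ is such that, for all $(\nu,\mu) \in \mathcal{P}_N\times\mathcal{P}_N$, $$\sum_{i=1}^N (g(i,\nu) - g(i,\mu))(\nu_i - \mu_i) \ge 0 \implies \nu=\mu,$$ and that $f$ is such that, for all $(\nu,\mu) \in \mathcal{P}_N\times\mathcal{P}_N$, $$\sum_{i=1}^N (f(i,\nu) - f(i,\mu))(\nu_i - \mu_i) \ge 0 \implies \nu=\mu.$$ Assume that, for all $i \in \mathcal{N}$, $\mathcal{H}(i,\cdot,\cdot)$ is differentiable with respect to $\mu$ on $\mathbb{R}^{d_i}\times\mathbb{R}_+^N$ and that, for all $j \in \mathcal{V}(i)$, $\frac{\partial \mathcal{H}}{\partial p_j}(i,\cdot,\cdot)$ is a $C^1$ function on $\mathbb{R}^{d_i}\times\mathbb{R}_+^N$. For $(q_1,\ldots,q_N,\mu) \in \prod_{i=1}^N\mathbb{R}^{d_i}\times\mathcal{P}_N$, with $q_i = (q_{ik})_{k\in\mathcal{V}(i)}$, define the following matrices: - $A(q_1,\ldots,q_N,\mu) = (\alpha_{ij}(q_i,\mu))_{i,j\in\mathcal{N}} \in \mathcal{M}_N$ with $\alpha_{ij}(q_i,\mu) = -\frac{\partial \mathcal{H}}{\partial \mu_j}(i,q_i,\mu)$; - for each $i\in\mathcal{N}$, $B^i(q_i,\mu) = (\beta^i_{jk}(q_i,\mu))_{j\in\mathcal{N},k\in\mathcal{V}(i)} \in \mathcal{M}_{N,d_i}$ with $\beta^i_{jk}(q_i,\mu) = \frac{\mu_i}{2}\frac{\partial^2\mathcal{H}}{\partial\mu_j\partial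 q_{ik}}(i,q_i,\mu)$; - for each $i\in\mathcal{N}$, $C^i(q_i,\mu) = (\gamma^i_{jk}(q_i,\mu))_{j\in\mathcal{V}(i),k\in\mathcal{N}} \in \mathcal{M}_{d_i,N}$ with $\gamma^i_{jk}(q_i,\mu) = \frac{\mu_i}{2}\frac{\partial^2\mathcal{H}}{\partial\mu_k\partial q_{ij}}(i,q_i,\mu)$; - for each $i\in\mathcal{N}$, $D^i(q_i,\mu) = (\delta^i_{jk}(q_i,\mu))_{j,k\in\mathcal{V}(i)} \in \mathcal{M}_{d_i}$ with $\delta^i_{jk}(q_i,\mu) = \mu_i\frac{\partial^2\mathcal{H}}{\partial q_{ij}\partial q_{ik}}(i,q_i,\mu)$. Assume that for all $(q_1,\ldots,q_N,\mu) \in \prod_{i=1}^N\mathbb{R}^{d_i}\times\mathcal{P}_N$, $$M(q_1,\ldots,q_N,\mu) = \begin{pmatrix} A(q_1,\ldots,q_N,\mu) & B^1(q_1,\mu) & \cdots & \cdots & B^N(q_N,\mu)\\ C^1(q_1,\mu) & D^1(q_1,\mu) & 0 & \cdots & 0\\ \vdots & 0 & \ddots & \ddots & \vdots\\ \vdots & \vdots & \ddots & \ddots & 0\\ C^N(q_N,\mu) & 0 & \cdots & 0 & D^N(q_N,\mu)\end{pmatrix} \ge 0.$$ Then, if $(\widehat{u},\widehat{m})$ and $(\tilde{u},\tilde{m})$ are two $C^1$ solutions of the $\mathcal{G}$-MFG equations (with the same initial distribution $m^0\in\mathcal{P}_N$), we have $\widehat{m}=\tilde{m}$ and $\widehat{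u}=\tilde{u}$.
   Context: Let $T>0$ and let $\mathcal{G}$ be a directed graph with node set $\mathcal{N} = \{1,\ldots,N\}$. For $i \in \mathcal{N}$, $\mathcal{V}(i) \subset \mathcal{N}\setminus\{i\}$ is the set of nodes $j$ such that there is a directed edge from $i$ to $j$, $d_i$ is the cardinality of $\mathcal{V}(i)$, and $\mathcal{V}^{-1}(i) \subset \mathcal{N}\setminus\{i\}$ is the set of nodes $j$ such that there is a directed edge from $j$ to $i$. Vectors $p \in \mathbb{R}^{d_i}$ are indexed by $\mathcal{V}(i)$: $p = (p_j)_{j\in\mathcal{V}(i)}$. Set $\mathbb{R}_+ = [0,\infty)$ and $\mathcal{P}_N = \{(\mu_1,\ldots,\mu_N) \in \mathbb{R}_+^N : \sum_{i=1}^N \mu_i = 1\}$. Matrices: $\mathcal{M}_{r,c}$ is the set of real matrices with $r$ rows and $c$ columns, and $\mathcal{M}_r = \mathcal{M}_{r,r}$. A square matrix $M\in\mathcal{M}_r$ (not necessarily symmetric) is called positive, written $M\ge 0$, if $y'My\ge 0$ for all $y\in\mathbb{R}^r$, where $y'$ is the transpose of $y$. For each $i \in \mathcal{N}$ there are given functions $\mathcal{L}(i,\cdot,\cdot) : \mathbb{R}_+^{d_i}\times\mathbb{R}_+^N \to \mathbb{R}_+$ (cost), $f(i,\cdot) : \mathbb{R}_+^N \to \mathbb{R}$ (instantaneous payoff) and $g(i,\cdot) : \mathbb{R}_+^N \to \mathbb{R}$ (terminal payoff), with the following standing assumptions for every $i\in\mathcal{N}$: - $\mathcal{L}(i,\cdot,\cdot)$,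 $f(i,\cdot)$ and $g(i,\cdot)$ are continuous; - for every $\mu \in \mathbb{R}_+^N$, $\mathcal{L}(i,\cdot,\mu)$ is strictly convex; - for every $K>0$, $\displaystyle\lim_{\lambda \in \mathbb{R}_+^{d_i},\,|\lambda|\to+\infty}\ \inf_{\mu \in [0,K]^N} \frac{\mathcal{L}(i,\lambda,\mu)}{|\lambda|} = +\infty$. The Hamiltonian functions are defined, for $i\in\mathcal{N}$ and $(p,\mu) \in \mathbb{R}^{d_i}\times\mathbb{R}_+^N$, by $$\mathcal{H}(i,p,\mu) = \sup_{\lambda \in \mathbb{R}_+^{d_i}} \lambda\cdot p - \mathcal{L}(i,\lambda,\mu).$$ It is a known fact that $\mathcal{H}(i,\cdot,\cdot)$ is continuous, that $\mathcal{H}(i,\cdot,\mu)$ is $C^1$ for every $\mu\in\mathbb{R}_+^N$, and that $\nabla_p\mathcal{H}(i,\cdot,\cdot)$ is continuous with $\nabla_p \mathcal{H}(i,p,\mu) = \mathrm{argmax}_{\lambda \in \mathbb{R}_+^{d_i}}\, \lambda\cdot p - \mathcal{L}(i,\lambda,\mu)$. For $j \in \mathcal{V}(i)$, $\frac{\partial\mathcal{H}}{\partial p_j}(i,p,\mu)$ denotes the partial derivative with respect to the component of $p$ indexed by $j$; when the second argument is written $q_i = (q_{ij})_{j\in\mathcal{V}(i)}$, the same derivative is denoted $\frac{\partial\mathcal{H}}{\partial q_{ij}}(i,q_i,\mu)$. $\frac{\partial\mathcal{H}}{\partial\mu_j}$ is the partial derivative with respect to the $j$-th component of $\mu$. Derivatives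 at boundary points of $\mathbb{R}_+^N$ are understood relative to $\mathbb{R}_+^N$ (one-sided). The $\mathcal{G}$-MFG equations with initial distribution $m^0\in\mathcal{P}_N$ are the following system of $2N$ equations, whose unknown is $t \in [0,T] \mapsto (u(t),m(t)) = (u(1,t),\ldots,u(N,t),m(1,t),\ldots,m(N,t))$, where $u(t)\in\mathbb{R}^N$ and $m(t) \in \mathcal{P}_N$: (Hamilton-Jacobi equations) for all $i\in\mathcal{N}$ and $t\in[0,T]$, $$\frac{d}{dt} u(i,t) + \mathcal{H}\left(i,(u(j,t)-u(i,t))_{j \in \mathcal{V}(i)},m(t)\right) + f(i,m(t))=0, \qquad u(i,T) = g(i,m(T));$$ (forward transport equations) for all $i\in\mathcal{N}$ and $t\in[0,T]$, $$\frac{d}{dt} m(i,t) = \sum_{j \in \mathcal{V}^{-1}(i)} \frac{\partial \mathcal{H}}{\partial p_i}\left(j,(u(k,t)-u(j,t))_{k \in \mathcal{V}(j)},m(t)\right) m(j,t) - \sum_{j \in \mathcal{V}(i)} \frac{\partial \mathcal{H}}{\partial p_j}\left(i,(u(k,t)-u(i,t))_{k \in \mathcal{V}(i)},m(t)\right) m(i,t),$$ with $(m(1,0),\ldots,m(N,0)) = m^0$. *)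

(* Defs.v *)
From HB Require Import structures.
From mathcomp Require Import all_boot all_order all_algebra.
From mathcomp Require Import all_classical all_reals all_analysis.
Import Order.TTheory GRing.Theory Num.Theory.
Import numFieldNormedType.Exports.

Set Implicit Arguments.
Unset Strict Implicit.
Unset Printing Implicit Defensive.

Local Open Scope classical_set_scope.
Local Open Scope ring_scope.

Definition orthant (R : realType) (n : nat) : set 'rV[R]_n :=
  [set x | forall k, 0 <= x 0 k].

Definition simplex (R : realType) (n : nat) : set 'rV[R]_n :=
  [set x | orthant x /\ \sum_(k < n) x 0 k = 1].

Definition dotv (R : realType) (n : nat) (x y : 'rV[R]_n) : R :=
  \sum_(k < n) x 0 k * y 0 k.

(* The library's [`|x|] on row vectors is the maximum norm. *)
Definition enorm (R : realType) (n : nat) (x : 'rV[R]_n) : R :=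
  Num.sqrt (dotv x x).

(* No symmetry is required. *)
Definition positive_mx (R : realType) (r : nat) (M : 'M[R]_r) : Prop :=
  forall y : 'cV[R]_r, 0 <= (y^T *m M *m y) 0 0.

(** Calculus relative to a subset [D], possibly not open: only values of the
    function on [D] matter, so derivatives at boundary points of [D] are
    one-sided. *)

(* Same as the library's [derive], except that [h] is restricted to the steps
   for which [h *: v + x] stays in [D]. *)
Definition derive_within (R : realType) (U W : normedModType R) (D : set U)
    (F : U -> W) (x v : U) : W :=
  lim (h^-1 *: (F (h *: v + x) - F x)
         @[h --> within [set h : R | D (h *: v + x)] 0^']).

Definition is_diff_within (R : realType) (U W : normedModType R) (D : set U)
    (F : U -> W) (x : U) (dF : {linear U -> W}) : Prop :=
  continuous dF /\
  forall eps : R, 0 < eps ->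
    \forall y \near within D (nbhs x),
      `|F y - F x - dF (y - x)| <= eps * `|y - x|.

Definition differentiable_within (R : realType) (U W : normedModType R)
    (D : set U) (F : U -> W) (x : U) : Prop :=
  exists dF : {linear U -> W}, is_diff_within D F x dF.

(* Continuity of the differential is stated vector by vector, which for a
   finite-dimensional [U] is the same as continuity for the operator norm. *)
Definition C1_on (R : realType) (U W : normedModType R) (D : set U)
    (F : U -> W) : Prop :=
  exists dF : U -> {linear U -> W},
    (forall x, D x -> is_diff_within D F x (dF x)) /\
    (forall v, {within D, continuous (fun x => dF x v)}).

Definition nbrs (N : nat) (E : rel 'I_N) (i : 'I_N) : {set 'I_N} :=
  [set j | E i j].

Definition outdeg (N : nat) (E : rel 'I_N) (i : 'I_N) : nat := #|nbrs E i|.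

(* A vector indexed by the neighbours of [i] is a row vector of length
   [outdeg E i], whose [k]-th coordinate belongs to this node. *)
Definition nbr (N : nat) (E : rel 'I_N) (i : 'I_N) (k : 'I_(outdeg E i)) :
  'I_N := enum_val k.

(* The basis vector belonging to the node [j]; it is meant for [E i j]. *)
Definition nbr_vec (R : realType) (N : nat) (E : rel 'I_N) (i j : 'I_N) :
    'rV[R]_(outdeg E i) :=
  \row_k (nbr k == j)%:R.

Definition nbr_diff (R : realType) (N : nat) (E : rel 'I_N) (u : 'rV[R]_N)
    (i : 'I_N) : 'rV[R]_(outdeg E i) :=
  \row_k (u 0 (nbr k) - u 0 i).

(* A total function; only its values on orthants are ever used. *)
Definition cost (R : realType) (N : nat) (E : rel 'I_N) : Type :=
  forall i : 'I_N, 'rV[R]_(outdeg E i) -> 'rV[R]_N -> R.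

Definition strictly_convex_on_orthant (R : realType) (n : nat)
    (F : 'rV[R]_n -> R) : Prop :=
  forall (x y : 'rV[R]_n) (t : R), orthant x -> orthant y -> x != y ->
    0 < t < 1 ->
    F (t *: x + (1 - t) *: y) < t * F x + (1 - t) * F y.

Definition superlinear (R : realType) (d n : nat)
    (F : 'rV[R]_d -> 'rV[R]_n -> R) : Prop :=
  forall K : R, 0 < K -> forall a : R, exists b : R,
    forall lam : 'rV[R]_d, orthant lam -> b <= enorm lam ->
      a <= inf [set F lam mu / enorm lam |
                 mu in [set mu : 'rV[R]_n | forall j, 0 <= mu 0 j <= K]].

(* For [mu] in the orthant, nonnegativity and superlinearity of [L i] make the
   set bounded above, so the real-valued [sup] is the true supremum. *)
Definition hamiltonian (R : realType) (N : nat) (E : rel 'I_N)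
    (L : cost R E) (i : 'I_N) (p : 'rV[R]_(outdeg E i)) (mu : 'rV[R]_N) : R :=
  sup [set dotv lam p - L i lam mu | lam in @orthant R (outdeg E i)].

Definition dp (R : realType) (N : nat) (E : rel 'I_N) (i j : 'I_N)
    (F : 'rV[R]_(outdeg E i) -> R) (p : 'rV[R]_(outdeg E i)) : R :=
  'D_(nbr_vec R E i j) F p.

Definition dmu (R : realType) (N : nat) (j : 'I_N) (F : 'rV[R]_N -> R)
    (mu : 'rV[R]_N) : R :=
  derive_within (@orthant R N) F mu (delta_mx 0 j).

(* Partial derivative of the Hamiltonian of [i] in the component of [p] that
   belongs to the neighbour [j]. *)
Definition dH_dp (R : realType) (N : nat) (E : rel 'I_N) (L : cost R E)
    (i j : 'I_N) (p : 'rV[R]_(outdeg E i)) (mu : 'rV[R]_N) : R :=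
  dp j (fun p' => hamiltonian L p' mu) p.

Definition mxA (R : realType) (N : nat) (E : rel 'I_N) (L : cost R E)
    (q : forall i, 'rV[R]_(outdeg E i)) (mu : 'rV[R]_N) : 'M[R]_N :=
  \matrix_(i, j) - dmu j (fun nu => hamiltonian L (q i) nu) mu.

Definition mxB (R : realType) (N : nat) (E : rel 'I_N) (L : cost R E)
    (i : 'I_N) (qi : 'rV[R]_(outdeg E i)) (mu : 'rV[R]_N) :
    'M[R]_(N, outdeg E i) :=
  \matrix_(j, k)
    (mu 0 i / 2 * dmu j (fun nu => dH_dp L (nbr k) qi nu) mu).

Definition mxC (R : realType) (N : nat) (E : rel 'I_N) (L : cost R E)
    (i : 'I_N) (qi : 'rV[R]_(outdeg E i)) (mu : 'rV[R]_N) :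
    'M[R]_(outdeg E i, N) :=
  \matrix_(j, k)
    (mu 0 i / 2 * dmu k (fun nu => dH_dp L (nbr j) qi nu) mu).

Definition mxD (R : realType) (N : nat) (E : rel 'I_N) (L : cost R E)
    (i : 'I_N) (qi : 'rV[R]_(outdeg E i)) (mu : 'rV[R]_N) :
    'M[R]_(outdeg E i) :=
  \matrix_(j, k)
    (mu 0 i * dp (nbr j) (fun q' => dH_dp L (nbr k) q' mu) qi).

Definition mxM (R : realType) (N : nat) (E : rel 'I_N) (L : cost R E)
    (q : forall i, 'rV[R]_(outdeg E i)) (mu : 'rV[R]_N) :
    'M[R]_(N + \sum_(i < N) outdeg E i) :=
  block_mx (mxA L q mu) (\mxrow_(i < N) mxB L (q i) mu)
           (\mxcol_(i < N) mxC L (q i) mu) (\mxdiag_(i < N) mxD L (q i) mu).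

(* Values of [u] and [m] outside [[0, T]] are irrelevant, and derivatives at [0]
   and [T] are one-sided. *)
Definition mfg_C1_solution (R : realType) (N : nat) (E : rel 'I_N)
    (L : cost R E) (f g : 'I_N -> 'rV[R]_N -> R) (T : R) (m0 : 'rV[R]_N)
    (u m : R -> 'rV[R]_N) : Prop :=
  let I : set R := [set t | 0 <= t <= T] in
  [/\ C1_on I u /\ C1_on I m,
      forall t, I t -> simplex (m t),
      forall i t, I t ->
        derive_within I (fun s => u s 0 i) t 1
        + hamiltonian L (nbr_diff E (u t) i) (m t) + f i (m t) = 0,
      forall i, u T 0 i = g i (m T) &
      (forall i t, I t ->
        derive_within I (fun s => m s 0 i) t 1 =
          \sum_(j | E j i)
             dH_dp L i (nbr_diff E (u t) j) (m t) * m t 0 j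
          - \sum_(j | E i j)
             dH_dp L j (nbr_diff E (u t) i) (m t) * m t 0 i) /\
      m 0 = m0].

(* The premise is the inequality [0 <= _]: the sum must be negative as soon as
   [nu != mu]. *)
Definition strictly_decreasing_on_simplex (R : realType) (N : nat)
    (h : 'I_N -> 'rV[R]_N -> R) : Prop :=
  forall nu mu : 'rV[R]_N, simplex nu -> simplex mu ->
    0 <= \sum_(i < N) (h i nu - h i mu) * (nu 0 i - mu 0 i) -> nu = mu.

(* Main.v *)
Require Import Defs.
From HB Require Import structures.
From mathcomp Require Import all_boot all_order all_algebra.
From mathcomp Require Import all_classical all_reals all_analysis.
From mathcomp Require Import ring lra.
Import Order.TTheory GRing.Theory Num.Theory.
Import numFieldNormedType.Exports.

Set Implicit Arguments.
Unset Strict Implicit.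
Unset Printing Implicit Defensive.

Local Open Scope classical_set_scope.
Local Open Scope ring_scope.

(** Let [(u1, m1)] and [(u2, m2)] be two solutions, [w = u1 - u2] and
    [n = m1 - m2]. The proof follows the pairing [W t = \sum_i w i t * n i t].
    It is zero at time 0, where the two distributions agree, and at time [T] it
    is the pairing of [g] along [n], which monotonicity of [g] makes
    nonpositive.
    Inserting both equations ([transport_pairing] turns the transport term into
    gradients of the Hamiltonians against [nbr_diff E w]), its derivative is the
    opposite of the pairing of [f] along [n], which is nonnegative, plus an
    interaction term built from the Hamiltonians and their gradients only.

    The interaction term is nonnegative ([hamiltonian_monotone]): it is the
    increment of one function along the segment joining the two states
    [(q, mu)], and the derivative of this function at each point of the segment
    is the quadratic form of the matrix [mxM] at the direction of the segment
    ([positive_mxM_ge0]). Hence [W] is nondecreasing, so [W T >= 0], and strict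
    monotonicity of [g] gives [m1 T = m2 T]. Then [W T = 0], [W] vanishes on
    [[0, T]], its derivative too, and strict monotonicity of [f] gives [m1 = m2]
    at every time ([mfg_distributions_eq]).

    With equal distributions [u1] and [u2] solve the same backward equation with
    the same final value. The gradients of the Hamiltonians are bounded along
    the two trajectories, by continuity, so a Gronwall argument on
    [\sum_i w i ^ 2] gives [u1 = u2] ([mfg_values_eq]).

    Two facts about the Hamiltonian [H] make this rigorous. First, the partial
    derivatives [dH_dp], which are limits with no convergence built in, really
    are the coordinates of the maximizer in the supremum defining [H]
    ([conjugate_partial], Danskin's theorem: strict convexity makes the
    maximizer unique, superlinear growth and compactness make it continuous in
    [p]); in particular the vector [gradH] that they form is a subgradient. Second, [H] is differentiable
    along segments in [(p, mu)] ([is_derive_hamiltonian]), although its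
    differentiability is assumed in [mu] only: the increment in [p] lies between
    two values of the gradient, which is jointly continuous.

    All functions live on sets with boundary (orthant, simplex, [[0, T]]), so
    derivatives are taken relative to a set throughout. *)

(** * One-sided calculus on a set *)

(** A predicate beside the function [derive_within], because the latter has a
    value even when the difference quotients diverge. *)
Definition is_derive_within (R : realType) (U W : normedModType R) (D : set U)
    (F : U -> W) (x v : U) (l : W) : Prop :=
  h^-1 *: (F (h *: v + x) - F x)
    @[h --> within [set h : R | D (h *: v + x)] 0^'] --> l.

Definition has_deriv (R : realType) (D : set R) (phi : R -> R) (x d : R) :=
  is_derive_within D (phi : R -> R^o) (x : R^o) 1 d.

Section Calculus.
Variable R : realType.

Lemma dnbhs0_neq : \forall h \near (0 : R)^', h != 0.
Proof. exact: nbhs_dnbhs_neq. Qed.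

Lemma cvg_sum_ord (T : Type) (F : set_system T) (FF : Filter F) n
    (phi : 'I_n -> T -> R) (a : 'I_n -> R) :
  (forall i, phi i x @[x --> F] --> a i) ->
  (\sum_i phi i x) @[x --> F] --> \sum_i a i.
Proof.
move=> H; elim: (index_enum _) => [|i s IH].
  by under eq_cvg do rewrite big_nil; rewrite big_nil; exact: cvg_cst.
by under eq_cvg do rewrite big_cons; rewrite big_cons; exact: cvgD.
Qed.

Lemma diff_is_derive_within (U W : normedModType R) (D : set U) (F : U -> W)
    (x : U) (dF : {linear U -> W}) (v : U) :
  is_diff_within D F x dF -> is_derive_within D F x v (dF v).
Proof.
move=> [_ Hd]; apply/cvgrPdist_le => eps eps0.
have e'0 : 0 < eps / (`|v| + 1) by rewrite divr_gt0 // ltr_wpDl.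
have := Hd _ e'0; rewrite near_withinE => Hn; rewrite near_withinE.
have cv : h *: v + x @[h --> (0 : R)^'] --> x.
  rewrite -[X in _ --> X]add0r -(scale0r v); apply: cvgD; last exact: cvg_cst.
  by apply: cvgZr_tmp; exact: nbhs_dnbhs.
have Hn' : \forall h \near (0 : R)^', D (h *: v + x) ->
    `|F (h *: v + x) - F x - dF (h *: v + x - x)|
      <= eps / (`|v| + 1) * `|h *: v + x - x| by exact: (cv _ Hn).
near=> h => Dh.
have h0 : h != 0 by near: h; exact: dnbhs0_neq.
have /(_ Dh) : D (h *: v + x) ->
    `|F (h *: v + x) - F x - dF (h *: v + x - x)|
      <= eps / (`|v| + 1) * `|h *: v + x - x| by near: h; exact: Hn'.
rewrite addrK linearZ /= normrZ => H.
rewrite -[dF v](scalerK h0) -scalerBr normrZ normfV distrC.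
rewrite mulrC ler_pdivrMr ?normr_gt0 //.
apply: (le_trans H).
have -> : eps / (`|v| + 1) * (`|h| * `|v|) = (eps * `|h|) * (`|v| / (`|v| + 1)).
  by ring.
rewrite ler_piMr ?mulr_ge0 ?(ltW eps0)//.
by rewrite ler_pdivrMr ?ltr_wpDl// mul1r lerDl.
Unshelve. all: by end_near. Qed.

(** Limits over admissible steps are unique as soon as there are arbitrarily
    small nonzero ones. *)
Lemma proper_steps (S : set R) :
  (forall e, 0 < e -> exists h, [/\ h != 0, `|h| < e & S h]) ->
  ProperFilter (within S (0 : R)^').
Proof.
move=> H; split=> [|]; last exact: within_filter.
rewrite /within /= => /nbhs_ballP [e /= e0 He].
have [h [h0 he Sh]] := H _ e0.
by have := He h; rewrite /ball /= sub0r normrN; apply.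
Qed.

Lemma derive_withinE (U : normedModType R) (D : set U) (F : U -> R)
    (x v : U) (l : R) :
  ProperFilter (within [set h : R | D (h *: v + x)] 0^') ->
  is_derive_within D (F : U -> R^o) x v l ->
  derive_within D F x v = l.
Proof. by move=> PF H; apply: cvg_lim. Qed.

Lemma is_derive_within_sub (U W : normedModType R) (D D' : set U) (F : U -> W)
    (x v : U) (l : W) : D' `<=` D ->
  is_derive_within D F x v l -> is_derive_within D' F x v l.
Proof.
move=> DD H; apply: cvg_trans H => A /=.
by rewrite /within /nbhs /=; apply: filterS => h Hh /DD.
Qed.

Lemma is_derive_within_cvg (U W : normedModType R) (D : set U) (F : U -> W)
    (x v : U) (l : W) : is_derive_within D F x v l ->
  F (h *: v + x) @[h --> within [set h : R | D (h *: v + x)] 0^'] --> F x.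
Proof.
move=> H.
have c0 : h @[h --> within [set h : R | D (h *: v + x)] 0^'] --> (0 : R).
  by move=> A /nbhs_dnbhs; exact: cvg_within.
have FF : Filter (within [set h : R | D (h *: v + x)] (0 : R)^').
  exact: within_filter.
have := cvgD (cvg_cst (F x)) (cvgZ c0 H) => /(_ FF FF FF).
rewrite scale0r addr0 => Hc; apply: cvg_trans Hc; apply: near_eq_cvg.
rewrite near_withinE; near=> h => Dh.
have h0 : h != 0 by near: h; exact: dnbhs0_neq.
by rewrite fctE /= scalerA divff // scale1r addrC subrK.
Unshelve. all: by end_near. Qed.
End Calculus.

Section HasDeriv.
Variable R : realType.
Implicit Types (D : set R) (phi psi : R -> R).

Lemma has_deriv_cst D c x : has_deriv D (fun=> c) x 0.
Proof.
have FF := within_filter [set h | D (h *: 1 + x)] (@dnbhs_filter R (0 : R)).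
apply: (cvg_trans _ (@cvg_cst R^o 0 _ _ FF)); apply: near_eq_cvg; near=> h.
by rewrite /= subrr scaler0.
Unshelve. all: by end_near. Qed.

Lemma has_derivD D phi psi x a b : has_deriv D phi x a -> has_deriv D psi x b ->
  has_deriv D (fun y => phi y + psi y) x (a + b).
Proof.
move=> Ha Hb.
have FF := within_filter [set h | D (h *: 1 + x)] (@dnbhs_filter R (0 : R)).
apply: (cvg_trans _ (cvgD Ha Hb)); apply: near_eq_cvg; near=> h.
by rewrite /= fctE /= -scalerDr addrACA opprD.
Unshelve. all: by end_near. Qed.

Lemma has_derivM D phi psi x a b : has_deriv D phi x a -> has_deriv D psi x b ->
  has_deriv D (fun y => phi y * psi y) x (a * psi x + phi x * b).
Proof.
move=> Ha Hb.
have FF := within_filter [set h | D (h *: 1 + x)] (@dnbhs_filter R (0 : R)).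
have Hc := is_derive_within_cvg Hb.
apply: (cvg_trans _ (cvgD (cvgM Ha Hc) (cvgM (cvg_cst (phi x)) Hb))).
apply: near_eq_cvg; near=> h.
rewrite /= fctE /= /GRing.scale /=; ring.
Unshelve. all: by end_near. Qed.

Lemma has_deriv_sum D n (phi : 'I_n -> R -> R) x (a : 'I_n -> R) :
  (forall i, has_deriv D (phi i) x (a i)) ->
  has_deriv D (fun y => \sum_i phi i y) x (\sum_i a i).
Proof.
move=> H.
pose P (f : R -> R) d := has_deriv D f x d.
suff : P (fun y => \sum_i phi i y) (\sum_i a i) by [].
elim: (index_enum _) => [|i s IH].
  rewrite big_nil (_ : (fun y => _) = fun=> 0); first exact: has_deriv_cst.
  by apply/funext => y; rewrite big_nil.
rewrite big_cons (_ : (fun y => _) = fun y => phi i y + \sum_(j <- s) phi j y).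
  exact: has_derivD.
by apply/funext => y; rewrite big_cons.
Qed.

Lemma has_deriv_affine D a b x : has_deriv D (fun y => y * a + b) x a.
Proof.
have FF := within_filter [set h | D (h *: 1 + x)] (@dnbhs_filter R (0 : R)).
apply: (cvg_trans _ (@cvg_cst R^o a _ _ FF)); apply: near_eq_cvg.
near=> h; have h0 : h != 0 by near: h; apply: cvg_within; exact: dnbhs0_neq.
by rewrite /= /GRing.scale /=; field.
Unshelve. all: by end_near. Qed.

Lemma has_derivN D phi x a : has_deriv D phi x a ->
  has_deriv D (fun y => - phi y) x (- a).
Proof.
move=> Ha; have := has_derivM (has_deriv_cst D (-1) x) Ha.
rewrite mul0r add0r mulN1r; congr has_deriv.
by apply/funext => y; rewrite mulN1r.
Qed.

Lemma has_derivB D phi psi x a b : has_deriv D phi x a -> has_deriv D psi x b ->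
  has_deriv D (fun y => phi y - psi y) x (a - b).
Proof. by move=> Ha /has_derivN; exact: has_derivD. Qed.

Lemma has_deriv_continuous D phi (d : R -> R) :
  (forall x, D x -> has_deriv D phi x (d x)) ->
  {within D, continuous phi}.
Proof.
move=> H; apply/subspace_continuousP => x Dx.
have /cvgrPdist_le Hc := is_derive_within_cvg (H x Dx).
apply/cvgrPdist_le => e e0; have := Hc e e0.
rewrite !near_withinE => /nbhs_ballP [r /= r0 Hr].
apply/nbhs_ballP; exists r => //= y yr Dy.
have [->|yx] := eqVneq y x; first by rewrite subrr normr0 ltW.
have := Hr (y - x); rewrite /ball /= sub0r opprB.
move: yr; rewrite /ball /= => yr /(_ yr); rewrite subr_eq0 => /(_ yx).
by rewrite /GRing.scale /= mulr1 subrK; apply.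
Qed.

Lemma is_derive_has_deriv D phi x d : nbhs x D ->
  has_deriv D phi x d -> is_derive x 1 phi d.
Proof.
move=> Dx H.
have {}H : h^-1 *: (phi (h *: 1 + x) - phi x) @[h --> (0 : R)^'] --> (d : R^o).
  apply: cvg_trans H => A; rewrite /= /within /= => HA.
  have /nbhs_dnbhs Hn : \forall h \near (0 : R), D (h *: 1 + x).
    have /nbhs_ballP [r /= r0 Hr] := Dx.
    apply/nbhs_ballP; exists r => //= h; rewrite /ball /= sub0r normrN => hr.
    by apply: Hr; rewrite /ball /= /GRing.scale /= mulr1 opprD addrCA subrr addr0 normrN.
  rewrite /nbhs /=; near=> h.
  have : D (h *: 1 + x) by near: h.
  by near: h.
split; first by apply/cvg_ex; exists d.
exact: cvg_lim H.
Unshelve. all: by end_near. Qed.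

(** In the interior of the interval the relative derivative is the two-sided
    one, to which the mean value theorem applies; at the ends it gives continuity. *)
Lemma has_deriv_ge0_le phi (d : R -> R) a b : a <= b ->
  (forall x, a <= x <= b -> has_deriv [set y | a <= y <= b] phi x (d x)) ->
  (forall x, a <= x <= b -> 0 <= d x) -> phi a <= phi b.
Proof.
move=> ab H d0.
have Iab : [set y | a <= y <= b] = `[a, b]%classic.
  by apply/seteqP; split=> y; rewrite /= in_itv.
have dv x : x \in `]a, b[ -> is_derive x 1 phi (d x).
  rewrite in_itv /= => /andP[ax xb].
  apply: (@is_derive_has_deriv `[a, b]%classic).
    have xab : x \in `]a, b[ by rewrite in_itv /= ax.
    apply: filterS (near_in_itvoo xab) => y /=.
    by rewrite !in_itv /= => /andP[/ltW-> /ltW->].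
  by rewrite -Iab; apply: H; rewrite !ltW.
apply: (@ger0_derive1_ndecr _ phi a b) => //.
- by move=> x /dv [].
- move=> x xab; rewrite derive1E (derive_val (is_derive := dv _ xab)).
  by apply: d0; move: xab; rewrite in_itv /= => /andP[/ltW-> /ltW->].
- by rewrite -Iab; exact: has_deriv_continuous H.
Qed.
End HasDeriv.

Section PathCalculus.
Variable R : realType.

Lemma cvg_row (T : Type) (F : set_system T) (FF : Filter F) n
    (phi : T -> 'rV[R]_n) (a : 'rV[R]_n) :
  (forall k, phi x 0 k @[x --> F] --> a 0 k) -> phi x @[x --> F] --> a.
Proof.
move=> H A [P HP PA].
have Hn : \forall x \near F, forall k, P 0 k (phi x 0 k).
  by apply: filter_forall => k; exact: (H k _ (HP 0 k)).
rewrite /nbhs /=; apply: filterS Hn => x Hx; apply: PA => i k.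
by rewrite (ord1 i).
Qed.

Lemma diff_within_cvg (U W : normedModType R) (D : set U) (F : U -> W) (x : U)
    (dF : {linear U -> W}) : is_diff_within D F x dF ->
  F y @[y --> within D (nbhs x)] --> F x.
Proof.
move=> [cdF H]; have FF : Filter (within D (nbhs x)) by exact: within_filter.
have Hd : dF (y - x) @[y --> nbhs x] --> (0 : W).
  have FFx : Filter (nbhs x) by exact: nbhs_filter.
  have c0 : y - x @[y --> nbhs x] --> (0 : U).
    rewrite -[X in _ --> X](subrr x).
    by apply: cvgB; [exact: cvg_id|exact: cvg_cst].
  by have := cvg_comp _ _ c0 (cdF 0); rewrite linear0.
apply/cvgrPdist_le => e e0; have e2 : 0 < e / 2 by rewrite divr_gt0.
have := H 1 ltr01; rewrite !near_withinE => H1.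
have /cvgrPdist_le /(_ _ e2) H2 := Hd.
have /cvgrPdist_le /(_ _ e2) H3 := @cvg_id _ (nbhs x).
near=> y => Dy.
have h1 : `|F y - F x - dF (y - x)| <= 1 * `|y - x|.
  by move: Dy; near: y; exact: H1.
have h2 : `|0 - dF (y - x)| <= e / 2 by near: y; exact: H2.
have h3 : `|x - y| <= e / 2 by near: y; exact: H3.
rewrite distrC -[F y - F x](subrK (dF (y - x))).
apply: (le_trans (ler_normD _ _)); rewrite [e]splitr lerD //.
  by apply: (le_trans h1); rewrite mul1r distrC.
by rewrite -normrN -sub0r.
Unshelve. all: by end_near. Qed.

Lemma itv_steps_proper (T t : R) : 0 < T -> 0 <= t <= T ->
  ProperFilter (within [set h : R | 0 <= h *: (1 : R^o) + t <= T] 0^').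
Proof.
move=> T0 /andP[t0 tT]; apply: proper_steps => e e0.
rewrite /GRing.scale /=.
have [tlt|tge] := ltP t T.
  have m0 : 0 < Num.min e (T - t) by rewrite lt_min e0 subr_gt0.
  have m1 : Num.min e (T - t) <= e by rewrite ge_min lexx.
  have m2 : Num.min e (T - t) <= T - t by rewrite ge_min lexx orbT.
  exists (Num.min e (T - t) / 2); split; first by rewrite gt_eqF ?divr_gt0.
    by rewrite gtr0_norm ?divr_gt0 //; lra.
  by apply/andP; split; lra.
have m0 : 0 < Num.min e T by rewrite lt_min e0.
have m1 : Num.min e T <= e by rewrite ge_min lexx.
have m2 : Num.min e T <= T by rewrite ge_min lexx orbT.
exists (- (Num.min e T / 2)); split; first by rewrite oppr_eq0 gt_eqF ?divr_gt0.
  by rewrite normrN gtr0_norm ?divr_gt0 //; lra.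
by apply/andP; split; lra.
Qed.

(** For a continuously differentiable curve the limit in [derive_within] exists,
    so the differential equations can be used as statements on [has_deriv]. *)
Lemma C1_coord_has_deriv (n : nat) (T t : R) (w : R -> 'rV[R]_n) (i : 'I_n) :
  0 < T -> 0 <= t <= T ->
  C1_on [set s : R | 0 <= s <= T] (w : (R : normedModType R) -> _) ->
  has_deriv [set s | 0 <= s <= T] (fun s => w s 0 i) t
    (derive_within [set s : R | 0 <= s <= T]
       ((fun s => w s 0 i) : (R : normedModType R) -> R) t 1).
Proof.
move=> T0 It [dw [Hdw _]].
have H := @diff_is_derive_within R _ _ _ _ _ _ (1 : R^o) (Hdw t It).
have Hc : has_deriv [set s | 0 <= s <= T] (fun s => w s 0 i) t (dw t 1 0 i).
  have := cvg_comp _ _ H (@coord_continuous R 1 n 0 i _).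
  apply: cvg_trans; apply: near_eq_cvg; apply: nearW => h.
  by rewrite /= !mxE.
suff -> : derive_within [set s : R | 0 <= s <= T]
   ((fun s => w s 0 i) : (R : normedModType R) -> R) t 1 = dw t 1 0 i by [].
apply: derive_withinE Hc; exact: itv_steps_proper.
Qed.

Lemma C1_within_cvg (n : nat) (T t : R) (w : R -> 'rV[R]_n) :
  0 <= t <= T ->
  C1_on [set s : R | 0 <= s <= T] (w : (R : normedModType R) -> _) ->
  w s @[s --> within [set s | 0 <= s <= T] (nbhs t)] --> w t.
Proof. by move=> It [dw [Hdw _]]; exact: diff_within_cvg (Hdw t It). Qed.

Lemma has_deriv_expR D (K x : R) :
  has_deriv D (fun y => expR (K * y)) x (K * expR (K * x)).
Proof.
have H : is_derive (x : R^o) 1 (fun y : R => expR (K * y)) (K * expR (K * x)).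
  apply: is_derive_eq.
  by rewrite /GRing.scale /=; ring.
have [Hc E] := H; rewrite -E.
by apply: cvg_trans Hc; exact: cvg_app (@cvg_within _ _ _ _).
Qed.
End PathCalculus.

(** * Danskin's theorem for the conjugate of a cost *)

Definition is_argmax (R : realType) (d : nat) (ell : 'rV[R]_d -> R)
    (p lam : 'rV[R]_d) : Prop :=
  orthant lam /\ forall lam', orthant lam' ->
    dotv lam' p - ell lam' <= dotv lam p - ell lam.

(** The Legendre transform of the cost; with [ell = L i ^~ mu] this is the
    Hamiltonian at [mu]. *)
Definition conjugate (R : realType) (d : nat) (ell : 'rV[R]_d -> R)
    (p : 'rV[R]_d) : R :=
  sup [set dotv lam p - ell lam | lam in @orthant R d].

Definition coercive (R : realType) (d : nat) (ell : 'rV[R]_d -> R) : Prop :=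
  forall a : R, exists b : R, forall lam, orthant lam -> b <= enorm lam ->
    a * enorm lam <= ell lam.

(** The bounds on [y] are multiples of [h], so that they have the same form for
    both signs of [h]. *)
Lemma squeeze_quotient (R : realFieldType) (h a b c y eps : R) : h != 0 ->
  h * a <= y <= h * b -> `|c - a| <= eps -> `|c - b| <= eps ->
  `|c - h^-1 * y| <= eps.
Proof.
move=> h0 /andP[ay yb]; rewrite !ler_norml => /andP[a1 a2] /andP[b1 b2].
have [hp|hn] : 0 < h \/ h < 0.
  by case: (ltgtP h 0) h0 => // _; [right|left].
- have : a <= h^-1 * y by rewrite mulrC ler_pdivlMr // mulrC.
  have : h^-1 * y <= b by rewrite mulrC ler_pdivrMr // mulrC.
  by move=> *; apply/andP; split; lra.
- have : h^-1 * y <= a by rewrite mulrC ler_ndivrMr // mulrC.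
  have : b <= h^-1 * y by rewrite mulrC ler_ndivlMr // mulrC.
  by move=> *; apply/andP; split; lra.
Qed.

Section Dotv.
Variables (R : realType) (d : nat).
Implicit Types x y z : 'rV[R]_d.

Lemma dotvBr x y z : dotv x (y - z) = dotv x y - dotv x z.
Proof.
by rewrite /dotv -sumrB; apply: eq_bigr => k _; rewrite !mxE mulrBr.
Qed.

Lemma dotvBl x y z : dotv (x - y) z = dotv x z - dotv y z.
Proof.
by rewrite /dotv -sumrB; apply: eq_bigr => k _; rewrite !mxE mulrBl.
Qed.

Lemma dotvDl x y z : dotv (x + y) z = dotv x z + dotv y z.
Proof.
by rewrite /dotv -big_split; apply: eq_bigr => k _; rewrite !mxE mulrDl.
Qed.

Lemma dotvZr c x y : dotv x (c *: y) = c * dotv x y.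
Proof.
by rewrite /dotv mulr_sumr; apply: eq_bigr => k _; rewrite !mxE mulrCA.
Qed.

Lemma dotvZl c x y : dotv (c *: x) y = c * dotv x y.
Proof.
by rewrite /dotv mulr_sumr; apply: eq_bigr => k _; rewrite !mxE mulrA.
Qed.

Lemma dot0v y : dotv 0 y = 0.
Proof. by rewrite /dotv big1 // => k _; rewrite mxE mul0r. Qed.

Lemma orthant0 : @orthant R d 0.
Proof. by move=> k; rewrite mxE. Qed.

Lemma coord_le_enorm x k : orthant x -> x 0 k <= enorm x.
Proof.
move=> x0; rewrite -[leLHS]ger0_norm // -sqrtr_sqr; apply: ler_wsqrtr.
rewrite /dotv (bigD1 k) //= -expr2 lerDl.
by apply: sumr_ge0 => j _; rewrite -expr2 sqr_ge0.
Qed.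

Lemma dotv_le x y a b :
  (forall k, `|x 0 k| <= a) -> (forall k, `|y 0 k| <= b) ->
  `|dotv x y| <= d%:R * (a * b).
Proof.
move=> xa yb; apply: (le_trans (ler_norm_sum _ _ _)).
rewrite -[d in leRHS]card_ord mulr_natl -sumr_const; apply: ler_sum => k _.
by rewrite normrM ler_pM.
Qed.

Lemma dotv_continuous y : continuous (fun x : 'rV[R]_d => dotv x y).
Proof.
move=> x; apply: (@cvg_sum_ord R _ (nbhs x)) => k.
by apply: cvgM; [exact: coord_continuous | exact: cvg_cst].
Qed.
End Dotv.

Section Conjugate.
Variables (R : realType) (d : nat) (ell : 'rV[R]_d -> R).
Hypothesis ell_cont : {within @orthant R d, continuous ell}.
Hypothesis ell_convex : strictly_convex_on_orthant ell.
Hypothesis ell_coercive : coercive ell.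
Implicit Types p lam : 'rV[R]_d.

Let box (B : R) : set 'rV[R]_d := [set lam | forall k, 0 <= lam 0 k <= B].

Let box_compact B : compact (box B).
Proof.
rewrite (_ : box B = [set v | forall k : 'I_d, `[0, B]%classic (v ord0 k)]).
  apply: (@rV_compact R d (fun=> `[0, B]%classic)) => k.
  exact: segment_compact.
by apply/seteqP; split=> v H k; have := H k; rewrite /= in_itv.
Qed.

Let box_orthant B : box B `<=` @orthant R d.
Proof. by move=> lam H k; have /andP[] := H k. Qed.

Let value_continuous p B :
  {within box B, continuous (fun lam => dotv lam p - ell lam)}.
Proof.
apply: (@continuous_subspaceW _ _ _ (@orthant R d)); first exact: box_orthant.
apply/subspace_continuousP => x ox.
have FF : Filter (within (@orthant R d) (nbhs x)) by exact: within_filter.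
move/subspace_continuousP: ell_cont => /(_ x ox) Hell.
by apply: cvgB Hell; apply: cvg_within_filter; exact: dotv_continuous.
Qed.

(** Coercivity beats the linear term [dotv lam p], which is at most
    [d * P * enorm lam]. One box serves all [p] bounded by [P], so that
    maximizers stay in a fixed compact set while [p] moves. *)
Lemma value_outside_box (P : R) : 0 <= P -> exists B, 0 <= B /\
  forall p, (forall k, `|p 0 k| <= P) -> forall lam, orthant lam ->
    ~ box B lam -> dotv lam p - ell lam < - ell 0.
Proof.
(* The extra slope 1 leaves [- enorm lam], which is below [- ell 0] far away. *)
move=> P0; have [b Hb] := ell_coercive (d%:R * P + 1).
exists (Num.max b `|ell 0|); split; first by rewrite le_max normr_ge0 orbT.
move=> p pP lam lam0 nb.
have [k Hk] : exists k, Num.max b `|ell 0| < lam 0 k.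
  apply: contrapT => /forallNP H; apply: nb => k.
  by rewrite lam0 /= leNgt; apply/negP/H.
have en := lt_le_trans Hk (coord_le_enorm k lam0).
move: en; rewrite gt_max => /andP[bn ln].
have := Hb _ lam0 (ltW bn).
have : `|dotv lam p| <= d%:R * (enorm lam * P).
  by apply: dotv_le => // j; rewrite ger0_norm ?coord_le_enorm.
rewrite mulrDl mul1r => /ler_normlP[_ h1] h2.
have h3 := ler_norm (ell 0).
have e : d%:R * (enorm lam * P) = d%:R * P * enorm lam by ring.
rewrite e in h1; lra.
Qed.

Lemma argmax_in_box (P : R) : 0 <= P -> exists B, 0 <= B /\
  forall p, (forall k, `|p 0 k| <= P) ->
    (exists2 lam, box B lam & is_argmax ell p lam) /\
    (forall lam, is_argmax ell p lam -> box B lam).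
Proof.
move=> P0; have [B [B0 HB]] := value_outside_box P0.
exists B; split=> // p pP.
have b0 : box B 0 by move=> k; rewrite mxE lexx.
split.
- have [|lam] := @EVT_max_rV R d _ (box B) _ (@box_compact B)
    (@value_continuous p B); first by exists 0.
  rewrite inE => blam Hlam; exists lam => //; split; first exact: box_orthant blam.
  move=> lam' o'; have [b'|nb'] := pselect (box B lam').
    by apply: Hlam; rewrite inE.
  apply: ltW; apply: (lt_le_trans (HB _ pP _ o' nb')).
  by have := Hlam 0; rewrite inE dot0v sub0r; apply.
- move=> lam [lam0 Hlam]; apply: contrapT => nb.
  have := Hlam 0 (@orthant0 R d); rewrite dot0v sub0r leNgt.
  by rewrite (HB _ pP _ lam0 nb).
Qed.

Let sumnorm p : R := \sum_k `|p 0 k|.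

Let sumnorm_ge0 p : 0 <= sumnorm p.
Proof. exact: sumr_ge0. Qed.

Let coord_le_sumnorm p k : `|p 0 k| <= sumnorm p.
Proof. by rewrite /sumnorm (bigD1 k) //= lerDl sumr_ge0. Qed.

Lemma argmax_exists p : exists lam, is_argmax ell p lam.
Proof.
have [B [_ /(_ p (coord_le_sumnorm p)) [[lam _ H] _]]] :=
  argmax_in_box (sumnorm_ge0 p).
by exists lam.
Qed.

(** By strict convexity the midpoint of two distinct maximizers would do
    better. *)
Lemma argmax_unique p lam lam' :
  is_argmax ell p lam -> is_argmax ell p lam' -> lam = lam'.
Proof.
move=> [oL H] [oL' H']; apply: contrapT => /eqP ne.
have h : 0 < (2^-1 : R) < 1 by lra.
have := ell_convex oL oL' ne h.
have om : orthant (2^-1 *: lam + (1 - 2^-1) *: lam').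
  move=> k; rewrite !mxE addr_ge0 // mulr_ge0 ?oL ?oL' //; lra.
have := H _ om; have := H _ oL'; have := H' _ oL.
rewrite dotvDl !dotvZl; lra.
Qed.

Lemma conjugateE p lam : is_argmax ell p lam ->
  conjugate ell p = dotv lam p - ell lam.
Proof.
move=> [oL H]; apply/le_anti/andP; split.
  apply: ge_sup; first by exists (dotv lam p - ell lam), lam.
  by move=> _ [lam' o' <-]; exact: H.
apply: sup_upper_bound; last by exists lam.
split; first by exists (dotv lam p - ell lam), lam.
by exists (dotv lam p - ell lam) => _ [lam' o' <-]; exact: H.
Qed.

(** The maximizer at [p] is a competitor in the supremum at [p']. *)
Lemma conjugate_subgradient p p' lam : is_argmax ell p lam ->
  dotv lam (p' - p) <= conjugate ell p' - conjugate ell p.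
Proof.
move=> Hlam; have [lam' Hlam'] := argmax_exists p'.
rewrite (conjugateE Hlam) (conjugateE Hlam') dotvBr.
have := Hlam'.2 lam Hlam.1; lra.
Qed.

(** A maximizer at [p'] that is [eps] away from [lam] in coordinate [k] loses a
    fixed gap at [p], by compactness and uniqueness; for [p'] near [p] the values
    at [p] and [p'] are too close for that. *)
Lemma argmax_continuous p lam k : is_argmax ell p lam ->
  forall eps : R, 0 < eps -> exists delta : R, 0 < delta /\
    forall p' lam', (forall j, `|p' 0 j - p 0 j| <= delta) ->
      is_argmax ell p' lam' -> `|lam' 0 k - lam 0 k| <= eps.
Proof.
move=> Hlam eps eps0.
have P0 : 0 <= sumnorm p + 1 by rewrite addr_ge0.
have [B [B0 HB]] := argmax_in_box P0.
pose K := box B `&` [set x | eps <= `|x 0 k - lam 0 k|].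
have near_bound p' : (forall j, `|p' 0 j - p 0 j| <= 1) ->
    forall j, `|p' 0 j| <= sumnorm p + 1.
  move=> H j; rewrite -[p' 0 j](subrK (p 0 j)) addrC.
  by apply: (le_trans (ler_normD _ _)); rewrite lerD.
have blam : box B lam.
  by apply: (HB p _).2 => // j; apply: (le_trans (coord_le_sumnorm p j)); lra.
have Kc : compact K.
  apply: (subclosed_compact _ (@box_compact B)); last by move=> x [].
  apply: closedI; first exact: (compact_closed _ (@box_compact B)).
  apply: (@closed_comp _ _ (fun x : 'rV[R]_d => `|x 0 k - lam 0 k|)
     [set y | eps <= y]); last exact: closed_ge.
  move=> x _; have FF : Filter (nbhs x) by exact: nbhs_filter.
  have := @cvgB _ R^o _ (nbhs x) FF _ _ _ _
    (@coord_continuous R 1 d 0 k x) (@cvg_cst R^o (lam 0 k) _ _ FF).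
  by move=> /cvg_norm; apply.
have [K0|/set0P [x0 Kx0]] := eqVneq K set0.
  exists 1; split=> // p' lam' H /(HB p' (near_bound p' H)).2 b'.
  rewrite leNgt; apply/negP => /ltW e'.
  by have : K lam' by []; rewrite K0.
have Kcont : {within K, continuous (fun lam => dotv lam p - ell lam)}.
  apply: continuous_subspaceW (@value_continuous p B); by move=> x [].
have [|c] := EVT_max_rV _ Kc Kcont; first by exists x0.
rewrite inE => -[bc ec] Hc.
have gap : dotv c p - ell c < dotv lam p - ell lam.
  have oc := box_orthant bc.
  (* In case of equality [c] is another maximizer at [p]. *)
  rewrite lt_neqAle Hlam.2 // andbT; apply/eqP => E.
  have cm : is_argmax ell p c by split=> // y /Hlam.2; rewrite E.
  move: ec => /=; rewrite (argmax_unique cm Hlam) subrr normr0; lra.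
set eta := (dotv lam p - ell lam) - (dotv c p - ell c).
have eta0 : 0 < eta by rewrite /eta; lra.
have dB0 : 0 < d%:R * B + 1 by rewrite ltr_wpDl // mulr_ge0.
(* The bound 1 keeps [p'] in the range of the box; with the other one,
   [dotv (lam' - lam) (p' - p)] is at most [eta / 2]. *)
exists (Num.min 1 (eta / 2 / (d%:R * B + 1))); split.
  by rewrite lt_min ltr01 !divr_gt0.
move=> p' lam' H Hlam'.
have H1 j : `|p' 0 j - p 0 j| <= 1.
  by apply: (le_trans (H j)); rewrite ge_min lexx.
have H2 j : `|(p' - p) 0 j| <= eta / 2 / (d%:R * B + 1).
  by rewrite !mxE; apply: (le_trans (H j)); rewrite ge_min lexx orbT.
have b' : box B lam' by exact: (HB p' (near_bound p' H1)).2.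
rewrite leNgt; apply/negP => /ltW e'.
have := Hc lam'; rewrite inE => /(_ (conj b' e')) h1.
have h2 := Hlam'.2 lam Hlam.1.
have : `|dotv (lam' - lam) (p' - p)| <=
    d%:R * (B * (eta / 2 / (d%:R * B + 1))).
  apply: dotv_le => // j; rewrite !mxE.
  have /andP[u1 u2] := b' j; have /andP[v1 v2] := blam j.
  by rewrite ler_norml; lra.
have -> : d%:R * (B * (eta / 2 / (d%:R * B + 1))) =
    (d%:R * B / (d%:R * B + 1)) * (eta / 2) by ring.
have q1 : d%:R * B / (d%:R * B + 1) <= 1 by rewrite ler_pdivrMr // mul1r lerDl.
have q2 : (d%:R * B / (d%:R * B + 1)) * (eta / 2) <= eta / 2.
  by rewrite ler_piMl // divr_ge0 // ltW.
rewrite ler_norml => /andP[_ h3].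
move: h1 h2 h3 q2; rewrite /eta dotvBl !dotvBr; lra.
Qed.

(** Danskin's theorem: the difference quotient lies between the [k]-th
    coordinates of the maximizers at [p] and at the shifted point, and the second
    tends to the first. *)
Lemma conjugate_partial p lam k : is_argmax ell p lam ->
  'D_(delta_mx 0 k) (conjugate ell) p = lam 0 k.
Proof.
move=> Hlam; apply: cvg_lim => //; apply/cvgrPdist_le => eps eps0.
have [delta [delta0 Hd]] := argmax_continuous k Hlam eps0.
have nz := @dnbhs0_neq R; have nd := @dnbhs0_le R R^o _ delta0.
near=> h.
have h0 : h != 0 by near: h.
have hd : `|h| <= delta by near: h.
set e := delta_mx 0 k; set p' := h *: e + p.
have dotk x : dotv x e = x 0 k.
  rewrite /dotv (bigD1 k) //= big1 ?addr0 => [|j jk].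
    by rewrite mxE !eqxx mulr1.
  by rewrite mxE (negbTE jk) andbF mulr0.
have [lam' Hlam'] := argmax_exists p'.
have Hk : `|lam' 0 k - lam 0 k| <= eps.
  apply: (Hd p' lam') => // j; rewrite !mxE addrK.
  by case: (_ == _); case: (_ == _); rewrite ?(mulr1, mulr0, normr0) // ltW.
have := conjugate_subgradient p' Hlam; have := conjugate_subgradient p Hlam'.
rewrite -[p - p']opprB addrK -scaleNr !dotvZr !dotk.
move=> h1 h2; rewrite /= -/p' /GRing.scale /=.
apply: (squeeze_quotient h0 (a := lam 0 k) (b := lam' 0 k)).
- by rewrite h2 /=; lra.
- by rewrite subrr normr0 ltW.
- by rewrite distrC.
Unshelve. all: by end_near. Qed.
End Conjugate.

(** * Derivatives along segments *)

(** Directional derivatives are derivatives along the line through the point. *)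
Lemma has_deriv_line (R : realType) (U : normedModType R) (D : set U)
    (F : U -> R) (x v : U) (S : set R) (t l : R) :
  (forall y, S y -> D (y *: v + x)) ->
  is_derive_within D (F : U -> R^o) (t *: v + x) v l ->
  has_deriv S (fun y => F (y *: v + x)) t l.
Proof.
move=> SD H.
have e h : h *: v + (t *: v + x) = (h *: 1 + t) *: v + x.
  by rewrite addrA -scalerDl /GRing.scale /= mulr1.
apply: (@is_derive_within_sub R R^o R^o [set y | D (y *: v + x)]) => //.
move: H; rewrite /is_derive_within.
rewrite (_ : [set h | D (h *: v + (t *: v + x))] =
  [set h : R | [set y | D (y *: v + x)] (h *: 1 + t)]); last first.
  by apply/seteqP; split => h /=; rewrite e.
apply: cvg_trans; apply: near_eq_cvg.
by apply: nearW => h; rewrite /= e.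
Qed.

Section PartialDerivatives.
Variable R : realType.

Lemma orthant_steps_proper (N : nat) (mu : 'rV[R]_N) (j : 'I_N) : orthant mu ->
  ProperFilter (within [set h : R | orthant (h *: delta_mx 0 j + mu)] 0^').
Proof.
move=> mu0; apply: proper_steps => e e0; exists (e / 2); split.
- by rewrite mulf_neq0 ?invr_eq0 ?gt_eqF.
- rewrite gtr0_norm ?divr_gt0 //; lra.
- by move=> k; rewrite !mxE addr_ge0 // mulr_ge0 ?divr_ge0 // ltW.
Qed.

Lemma dmu_diff (N : nat) (F : 'rV[R]_N -> R) (mu : 'rV[R]_N) dF
    (j : 'I_N) : orthant mu -> is_diff_within (@orthant R N) (F : _ -> R^o) mu dF ->
  dmu j F mu = dF (delta_mx 0 j).
Proof.
move=> mu0 H; apply: derive_withinE; first exact: orthant_steps_proper.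
exact: diff_is_derive_within.
Qed.

Lemma row_delta_sum (N : nat) (n : 'rV[R]_N) :
  n = \sum_j n 0 j *: delta_mx 0 j.
Proof.
by rewrite [LHS]matrix_sum_delta big_ord1.
Qed.

Lemma is_derive_within_orthant (N : nat) (F : 'rV[R]_N -> R)
    (mu n : 'rV[R]_N) : orthant mu ->
  differentiable_within (@orthant R N) (F : _ -> R^o) mu ->
  is_derive_within (@orthant R N) (F : _ -> R^o) mu n
    (\sum_j n 0 j * dmu j F mu).
Proof.
move=> mu0 [dF H].
suff -> : \sum_j n 0 j * dmu j F mu = dF n by exact: diff_is_derive_within.
rewrite [in RHS](row_delta_sum n) linear_sum; apply: eq_bigr => j _.
by rewrite (dmu_diff _ mu0 H) linearZ.
Qed.

(** Joint differentiability identifies both kinds of partial derivatives that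
    occur in the matrix, two-sided in [p] and one-sided in [mu], with values of
    a single linear map, which can then be evaluated at [(v, n)]. *)
Lemma is_derive_within_prod (d N : nat) (G : 'rV[R]_d -> 'rV[R]_N -> R)
    (p v : 'rV[R]_d) (mu n : 'rV[R]_N) : orthant mu ->
  differentiable_within [set z : 'rV[R]_d * 'rV[R]_N | orthant z.2]
    ((fun z => G z.1 z.2) : _ -> R^o) (p, mu) ->
  is_derive_within [set z : 'rV[R]_d * 'rV[R]_N | orthant z.2]
    ((fun z => G z.1 z.2) : _ -> R^o) (p, mu) (v, n)
    (\sum_j v 0 j * 'D_(delta_mx 0 j) (G^~ mu) p
     + \sum_j n 0 j * dmu j (G p) mu).
Proof.
move=> mu0 [dG H].
have Hp j : 'D_(delta_mx 0 j) (G^~ mu) p = dG (delta_mx 0 j, 0).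
  have := @diff_is_derive_within R _ _ _ _ _ _ (delta_mx 0 j, 0) H.
  rewrite /is_derive_within /= => Hc.
  apply: cvg_lim => //; apply: cvg_trans Hc => A.
  rewrite /nbhs /= /within /nbhs /=; apply: filterS => h /=.
  by rewrite scaler0 add0r; apply.
have Hn j : dmu j (G p) mu = dG (0, delta_mx 0 j).
  apply: derive_withinE; first exact: orthant_steps_proper.
  have := @diff_is_derive_within R _ _ _ _ _ _ (0, delta_mx 0 j) H.
  rewrite /is_derive_within /= => Hc.
  apply: cvg_trans Hc; apply: near_eq_cvg; apply: nearW => h /=.
  by rewrite scaler0 add0r.
suff -> : \sum_j v 0 j * 'D_(delta_mx 0 j) (G^~ mu) p
     + \sum_j n 0 j * dmu j (G p) mu = dG (v, n).
  exact: diff_is_derive_within.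
have -> : (v, n) = (\sum_j v 0 j *: (delta_mx 0 j, 0)) +
    (\sum_j n 0 j *: (0, delta_mx 0 j)) :> 'rV[R]_d * 'rV[R]_N.
  have e1 : \sum_j v 0 j *: ((delta_mx 0 j, 0) : 'rV[R]_d * 'rV[R]_N) = (v, 0).
    rewrite [in RHS](row_delta_sum v).
    by elim/big_rec2: _ => // j y1 y2 _ ->; congr pair; rewrite /= ?addr0 ?add0r ?scaler0.
  have e2 : \sum_j n 0 j *: ((0, delta_mx 0 j) : 'rV[R]_d * 'rV[R]_N) = (0, n).
    rewrite [in RHS](row_delta_sum n).
    by elim/big_rec2: _ => // j y1 y2 _ ->; congr pair; rewrite /= ?addr0 ?add0r ?scaler0.
  by rewrite e1 e2; congr pair; rewrite ?addr0 ?add0r.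
rewrite linearD !linear_sum; congr (_ + _); apply: eq_bigr => j _.
  by rewrite linearZ Hp.
by rewrite linearZ Hn.
Qed.
End PartialDerivatives.

(** * The quadratic form of the matrix *)

Lemma mulmx_row_colE (R : comPzRingType) (p q : nat) (a : 'rV[R]_p)
    (M : 'M[R]_(p, q)) (b : 'rV[R]_q) :
  (a *m M *m b^T) 0 0 = \sum_i \sum_j a 0 i * M i j * b 0 j.
Proof.
rewrite mxE exchange_big; apply: eq_bigr => j _.
by rewrite !mxE mulr_suml.
Qed.

Section QuadraticForm.
Variables (R : realType) (N : nat) (E : rel 'I_N) (L : cost R E).

(** The sum is the value of the quadratic form of [mxM] at the vector with
    blocks [n], [v 0], [v 1], and so on, arranged as the chain rule produces it; the
    factors 1/2 of the blocks [mxB] and [mxC] add up. *)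
Lemma positive_mxM_ge0 (q v : forall i, 'rV[R]_(outdeg E i))
    (mu n : 'rV[R]_N) : positive_mx (mxM L q mu) ->
  0 <= \sum_i
    (mu 0 i * (\sum_k v i 0 k *
       (\sum_j v i 0 j * dp (nbr j) (fun q' => dH_dp L (nbr k) q' mu) (q i)
        + \sum_j n 0 j * dmu j (fun nu => dH_dp L (nbr k) (q i) nu) mu))
     - n 0 i * (\sum_j n 0 j * dmu j (fun nu => hamiltonian L (q i) nu) mu)).
Proof.
move=> /(_ (col_mx n^T (\mxcol_i (v i)^T))).
rewrite tr_col_mx trmxK tr_mxcol.
under eq_mxrow do rewrite trmxK.
rewrite /mxM mul_row_block mul_row_col !mulmxDl.
rewrite -[n *m (\mxrow_i _) *m _]mulmxA -[\mxrow_i _ *m (\mxdiag_i _) *m _]mulmxA.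
rewrite mul_mxdiag_mxcol !mul_mxrow_mxcol mulmx_suml mulmx_sumr.
have addE (X Y : 'M[R]_1) : (X + Y) 0 0 = X 0 0 + Y 0 0 by rewrite mxE.
rewrite !addE !summxE mulmx_row_colE.
rewrite -!big_split /= => /le_trans; apply; rewrite le_eqVlt; apply/orP; left.
apply/eqP; apply: eq_bigr => i _.
rewrite !mulmxA !mulmx_row_colE.
pose G (k : 'I_(outdeg E i)) := \sum_j n 0 j * dmu j (fun nu => dH_dp L (nbr k) (q i) nu) mu.
have eA : \sum_j n 0 i * mxA L q mu i j * n 0 j =
    - (n 0 i * \sum_j n 0 j * dmu j (fun nu => hamiltonian L (q i) nu) mu).
  rewrite mulr_sumr -sumrN; apply: eq_bigr => j _; rewrite mxE; ring.
have eC : \sum_k \sum_j v i 0 k * mxC L (q i) mu k j * n 0 j =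
    mu 0 i / 2 * \sum_k v i 0 k * G k.
  rewrite mulr_sumr; apply: eq_bigr => k _; rewrite /G !mulr_sumr.
  by apply: eq_bigr => j _; rewrite mxE; ring.
have eB : \sum_j \sum_k n 0 j * mxB L (q i) mu j k * v i 0 k =
    mu 0 i / 2 * \sum_k v i 0 k * G k.
  rewrite exchange_big mulr_sumr; apply: eq_bigr => k _; rewrite /G !mulr_sumr.
  by apply: eq_bigr => j _; rewrite mxE; ring.
have eD : \sum_j \sum_k v i 0 j * mxD L (q i) mu j k * v i 0 k =
    mu 0 i * \sum_k v i 0 k *
      \sum_j v i 0 j * dp (nbr j) (fun q' => dH_dp L (nbr k) q' mu) (q i).
  rewrite exchange_big mulr_sumr; apply: eq_bigr => k _; rewrite !mulr_sumr.
  by apply: eq_bigr => j _; rewrite mxE; ring.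
rewrite eA eC eB eD; under [in RHS]eq_bigr do rewrite mulrDr.
rewrite big_split /G /=; lra.
Qed.
End QuadraticForm.

(** * The Hamiltonian in both variables *)

Definition gradH (R : realType) (N : nat) (E : rel 'I_N) (L : cost R E)
    (i : 'I_N) (p : 'rV[R]_(outdeg E i)) (mu : 'rV[R]_N) :
    'rV[R]_(outdeg E i) :=
  \row_k dH_dp L (nbr k) p mu.

Section Hamiltonian.
Variables (R : realType) (N : nat) (E : rel 'I_N) (L : cost R E).
Arguments L : clear implicits.
Hypothesis L_ge0 : forall i lam mu, orthant lam -> orthant mu ->
  0 <= L i lam mu.
Hypothesis L_cont : forall i,
  {within [set z : 'rV[R]_(outdeg E i) * 'rV[R]_N
            | orthant z.1 /\ orthant z.2],
    continuous (fun z => L i z.1 z.2)}.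
Hypothesis L_convex : forall i mu, orthant mu ->
  strictly_convex_on_orthant (fun lam => L i lam mu).
Hypothesis L_superlinear : forall i, superlinear (L i).

Let ell i mu : 'rV[R]_(outdeg E i) -> R := fun lam => L i lam mu.

Let ell_cont i mu : orthant mu ->
  {within @orthant R (outdeg E i), continuous (@ell i mu)}.
Proof.
move=> mu0; apply/subspace_continuousP => x ox.
have /subspace_continuousP /(_ (x, mu) (conj ox mu0)) := @L_cont i.
move=> H A /H; rewrite /nbhs /= /within /=.
move=> [[U V] /= [HU HV] UV]; apply: filterS HU => y Uy oy.
by apply: (UV (y, mu)) => //; split=> //=; exact: nbhs_singleton.
Qed.

Let ell_coercive i mu : orthant mu -> coercive (@ell i mu).
Proof.
move=> mu0 a; pose K : R := 1 + \sum_j mu 0 j.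
have K0 : 0 < K by rewrite ltr_pwDl // sumr_ge0.
have [b Hb] := @L_superlinear i K K0 a.
exists (Num.max b 1) => lam lam0; rewrite ge_max => /andP[bl l1].
have e0 : 0 < enorm lam by apply: lt_le_trans l1.
rewrite -ler_pdivlMr //; apply: (le_trans (Hb _ lam0 bl)).
apply: inf_lbound.
  exists 0 => _ [nu Hnu <-]; apply: divr_ge0; last exact: ltW.
  by apply: L_ge0 => // j; have /andP[] := Hnu j.
exists mu => //= j; rewrite mu0 /= /K.
by apply: ler_wpDl => //; rewrite (bigD1 j) //= lerDl sumr_ge0.
Qed.

Lemma nbr_vec_delta (i : 'I_N) (k : 'I_(outdeg E i)) :
  nbr_vec R E i (nbr k) = delta_mx 0 k.
Proof.
apply/rowP => j; rewrite !mxE eqxx /= /nbr.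
by rewrite (inj_eq enum_val_inj).
Qed.

(** The limits that define [dH_dp] exist, by Danskin's theorem. *)
Lemma gradH_argmax i (p : 'rV[R]_(outdeg E i)) mu : orthant mu ->
  is_argmax (fun lam => L i lam mu) p (gradH L p mu).
Proof.
move=> mu0.
have [lam Hlam] := argmax_exists (@ell_cont i mu mu0) (@ell_coercive i mu mu0) p.
suff -> : gradH L p mu = lam by [].
apply/rowP => k; rewrite mxE /dH_dp /dp nbr_vec_delta.
exact: (conjugate_partial (@ell_cont i mu mu0) (@L_convex i mu mu0)
  (@ell_coercive i mu mu0)).
Qed.

Lemma hamiltonian_subgradient i (p p' : 'rV[R]_(outdeg E i)) mu :
  orthant mu ->
  dotv (gradH L p mu) (p' - p) <= hamiltonian L p' mu - hamiltonian L p mu.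
Proof.
move=> mu0.
exact: (conjugate_subgradient (@ell_cont i mu mu0) (@ell_coercive i mu mu0) p'
  (gradH_argmax p mu0)).
Qed.

Hypothesis H_diff : forall i (p : 'rV[R]_(outdeg E i)) (mu : 'rV[R]_N),
  orthant mu ->
  differentiable_within (@orthant R N) (fun nu => hamiltonian L p nu) mu.
Hypothesis dH_C1 : forall i j, j \in nbrs E i ->
  C1_on [set z : 'rV[R]_(outdeg E i) * 'rV[R]_N | orthant z.2]
        (fun z => dH_dp L j z.1 z.2).

Lemma is_derive_dH i (k : 'I_(outdeg E i)) (p v : 'rV[R]_(outdeg E i)) mu n :
  orthant mu ->
  is_derive_within [set z : 'rV[R]_(outdeg E i) * 'rV[R]_N | orthant z.2]
    ((fun z => dH_dp L (nbr k) z.1 z.2) : _ -> R^o) (p, mu) (v, n)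
    (\sum_j v 0 j * dp (nbr j) (fun q => dH_dp L (nbr k) q mu) p
     + \sum_j n 0 j * dmu j (fun nu => dH_dp L (nbr k) p nu) mu).
Proof.
move=> mu0; rewrite /dp; under eq_bigr do rewrite nbr_vec_delta.
apply: is_derive_within_prod => //.
have kn : nbr k \in nbrs E i by exact: enum_valP.
by have [dF [HdF _]] := @dH_C1 i _ kn; exists (dF (p, mu)); exact: HdF.
Qed.

(** The Hamiltonian is assumed differentiable in [mu] only, at fixed [p]. The
    remaining increment, in [p] at the moved [mu], is squeezed by the
    subgradient inequalities between two values of the jointly continuous gradient. *)
Lemma is_derive_hamiltonian i (p v : 'rV[R]_(outdeg E i)) mu n : orthant mu ->
  is_derive_within [set z : 'rV[R]_(outdeg E i) * 'rV[R]_N | orthant z.2]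
    ((fun z => hamiltonian L z.1 z.2) : _ -> R^o) (p, mu) (v, n)
    (dotv (gradH L p mu) v
     + \sum_j n 0 j * dmu j (fun nu => hamiltonian L p nu) mu).
Proof.
move=> mu0.
have Hmu := @is_derive_within_orthant R N _ mu n mu0 (@H_diff i p mu mu0).
set F := within [set h : R | orthant (h *: n + mu)] 0^'.
have FF : Filter F by exact: within_filter.
have grad_cvg (w : 'rV[R]_(outdeg E i)) (P : R -> 'rV[R]_(outdeg E i)) :
    (forall h, P h = h *: w + p) ->
    dotv (gradH L (P h) (h *: n + mu)) v @[h --> F] --> dotv (gradH L p mu) v.
  move=> eP; apply: cvg_sum_ord => k; apply: cvgM; last exact: cvg_cst.
  have := is_derive_within_cvg (@is_derive_dH i k p w mu n mu0).
  by rewrite /= => Hc; rewrite mxE; under eq_cvg do rewrite mxE eP; exact: Hc.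
suff Hp : h^-1 * (hamiltonian L (h *: v + p) (h *: n + mu)
                  - hamiltonian L p (h *: n + mu)) @[h --> F] -->
    dotv (gradH L p mu) v.
  apply: (cvg_trans _ (cvgD Hp Hmu)); apply: near_eq_cvg.
  by apply: nearW => h; rewrite fctE /= /GRing.scale /=; ring.
have /cvgrPdist_le g1 := grad_cvg v _ (fun=> erefl).
have /cvgrPdist_le g2 : dotv (gradH L p (h *: n + mu)) v @[h --> F] -->
    dotv (gradH L p mu) v.
  by apply: (grad_cvg 0 (fun=> p)) => h; rewrite scaler0 add0r.
apply/cvgrPdist_le => eps eps0.
have := g1 _ eps0; rewrite /F near_withinE => {}g1.
have := g2 _ eps0; rewrite /F near_withinE => {}g2.
rewrite near_withinE; near=> h => oh.
have h0 : h != 0 by near: h; exact: dnbhs0_neq.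
have /(_ oh) : orthant (h *: n + mu) -> `|dotv (gradH L p mu) v -
   dotv (gradH L (h *: v + p) (h *: n + mu)) v| <= eps by near: h; exact: g1.
have /(_ oh) : orthant (h *: n + mu) -> `|dotv (gradH L p mu) v -
   dotv (gradH L p (h *: n + mu)) v| <= eps by near: h; exact: g2.
move=> ea eb; apply: squeeze_quotient h0 _ ea eb.
have h1 := hamiltonian_subgradient p (h *: v + p) oh.
have := hamiltonian_subgradient (h *: v + p) p oh.
rewrite -[p - _]opprB; move: h1; rewrite addrK -scaleNr !dotvZr mulNr => -> /=.
by move=> h2; rewrite -lerN2 opprB.
Unshelve. all: by end_near. Qed.
Hypothesis M_pos : forall (q : forall i, 'rV[R]_(outdeg E i)) (mu : 'rV[R]_N),
  simplex mu -> positive_mx (mxM L q mu).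

Lemma simplex_segment (mu nu : 'rV[R]_N) (y : R) : simplex mu -> simplex nu ->
  0 <= y <= 1 -> simplex (y *: (mu - nu) + nu).
Proof.
move=> [mu0 mu1] [nu0 nu1] /andP[y0 y1].
have e k : (y *: (mu - nu) + nu) 0 k = y * mu 0 k + (1 - y) * nu 0 k.
  by rewrite !mxE; ring.
split=> [k|]; first by rewrite e addr_ge0 // mulr_ge0 // subr_ge0.
under eq_bigr do rewrite e.
by rewrite big_split /= -!mulr_sumr mu1 nu1; ring.
Qed.

(** The difference of the two sides is the increment, along the segment from
    [(r, nu)] to [(q, mu)], of a function whose derivative is the quadratic form
    of [mxM]: the terms [n i * dotv (gradH _ _) (v i)] coming from the weight
    [mu i] and from the Hamiltonian cancel. *)
Lemma hamiltonian_monotone (q r : forall i, 'rV[R]_(outdeg E i))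
    (mu nu : 'rV[R]_N) : simplex mu -> simplex nu ->
  \sum_i (nu 0 i * dotv (gradH L (r i) nu) (q i - r i)
          - (mu - nu) 0 i * hamiltonian L (r i) nu) <=
  \sum_i (mu 0 i * dotv (gradH L (q i) mu) (q i - r i)
          - (mu - nu) 0 i * hamiltonian L (q i) mu).
Proof.
move=> smu snu; set n := mu - nu; pose v i := q i - r i.
pose S : set R := [set y | 0 <= y <= 1].
pose qt (y : R) i := y *: v i + r i; pose mt (y : R) := y *: n + nu.
have smt y : S y -> simplex (mt y) by move=> Sy; exact: simplex_segment.
pose Phi y := \sum_i ((y * n 0 i + nu 0 i) * dotv (gradH L (qt y i) (mt y)) (v i)
          - n 0 i * hamiltonian L (qt y i) (mt y)).
pose DG y i (k : 'I_(outdeg E i)) :=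
  \sum_j v i 0 j * dp (nbr j) (fun q' => dH_dp L (nbr k) q' (mt y)) (qt y i)
  + \sum_j n 0 j * dmu j (fun nu' => dH_dp L (nbr k) (qt y i) nu') (mt y).
pose DH y i :=
  \sum_j n 0 j * dmu j (fun nu' => hamiltonian L (qt y i) nu') (mt y).
have dGk y i k : S y -> has_deriv S
    (fun y => gradH L (qt y i) (mt y) 0 k) y (DG y i k).
  move=> Sy; under eq_fun do rewrite mxE.
  apply: (@has_deriv_line R _ [set z | orthant z.2]
    (fun z : 'rV[R]_(outdeg E i) * 'rV[R]_N => dH_dp L (nbr k) z.1 z.2)
    (r i, nu) (v i, n)).
    by move=> t /smt [].
  exact: (@is_derive_dH i k (qt y i) (v i) (mt y) n (smt _ Sy).1).
have dH y i : S y -> has_deriv S (fun y => hamiltonian L (qt y i) (mt y)) y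
    (dotv (gradH L (qt y i) (mt y)) (v i) + DH y i).
  move=> Sy; apply: (@has_deriv_line R _ [set z | orthant z.2]
    (fun z : 'rV[R]_(outdeg E i) * 'rV[R]_N => hamiltonian L z.1 z.2)
    (r i, nu) (v i, n)).
    by move=> t /smt [].
  exact: (@is_derive_hamiltonian i (qt y i) (v i) (mt y) n (smt _ Sy).1).
pose d y := \sum_i ((y * n 0 i + nu 0 i) * (\sum_k v i 0 k * DG y i k)
                    - n 0 i * DH y i).
have dPhi y : S y -> has_deriv S Phi y (d y).
  move=> Sy; apply: has_deriv_sum => i.
  have dg : has_deriv S (fun y => dotv (gradH L (qt y i) (mt y)) (v i)) y
      (\sum_k v i 0 k * DG y i k).
    apply: has_deriv_sum => k.
    have := has_derivM (dGk y i k Sy) (has_deriv_cst S (v i 0 k) y).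
    by rewrite mulr0 addr0 mulrC.
  have := has_derivB (has_derivM (@has_deriv_affine R S (n 0 i) (nu 0 i) y) dg)
    (has_derivM (@has_deriv_cst R S (n 0 i) y) (dH y i Sy)).
  congr has_deriv; ring.
have : Phi 0 <= Phi 1.
  apply: (has_deriv_ge0_le (d := d)) => // y Sy.
  have := positive_mxM_ge0 v n (@M_pos (qt y) (mt y) (smt _ Sy)).
  have em i : mt y 0 i = y * n 0 i + nu 0 i by rewrite mxE [X in X + _]mxE.
  by under eq_bigr do rewrite em.
rewrite /Phi; under eq_bigr do rewrite mul0r add0r /qt /mt !scale0r !add0r.
under [leRHS]eq_bigr do rewrite mul1r /qt /mt !scale1r /v !subrK.
have e i : n 0 i + nu 0 i = mu 0 i by rewrite /n !mxE subrK.
by under [leRHS]eq_bigr do rewrite e.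
Qed.
End Hamiltonian.

(** * Equality of the distributions *)

(** Summation by parts on the graph: the mass leaving [i] along an edge is the
    mass that arrives at the other end. *)
Lemma transport_pairing (R : realType) (N : nat) (E : rel 'I_N) (L : cost R E)
    (q : forall i, 'rV[R]_(outdeg E i)) (mu w : 'rV[R]_N) :
  \sum_i w 0 i * (\sum_(j | E j i) dH_dp L i (q j) mu * mu 0 j
                  - \sum_(j | E i j) dH_dp L j (q i) mu * mu 0 i) =
  \sum_i mu 0 i * dotv (gradH L (q i) mu) (nbr_diff E w i).
Proof.
under eq_bigr do rewrite mulrBr !mulr_sumr.
rewrite sumrB /= (exchange_big_dep xpredT) //= -sumrB; apply: eq_bigr => i _.
rewrite -sumrB /dotv mulr_sumr.
transitivity (\sum_(j in nbrs E i)
  mu 0 i * (dH_dp L j (q i) mu * (w 0 j - w 0 i))).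
  by apply: eq_big => [j|j _]; [rewrite inE|ring].
by rewrite big_enum_val; apply: eq_bigr => k _; rewrite !mxE.
Qed.

Lemma strictly_decreasing_le0 (R : realType) (N : nat)
    (h : 'I_N -> 'rV[R]_N -> R) (nu mu : 'rV[R]_N) :
  strictly_decreasing_on_simplex h -> simplex nu -> simplex mu ->
  \sum_(i < N) (h i nu - h i mu) * (nu 0 i - mu 0 i) <= 0.
Proof.
move=> hd snu smu; rewrite leNgt; apply/negP => pos.
have e := hd _ _ snu smu (ltW pos); move: pos; rewrite e big1 ?ltxx // => i _.
by rewrite subrr mul0r.
Qed.

Section Solutions.
Variables (R : realType) (T : R) (N : nat) (E : rel 'I_N) (L : cost R E).
Variables (f g : 'I_N -> 'rV[R]_N -> R) (m0 : 'rV[R]_N).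
Hypothesis T_gt0 : 0 < T.
Let I : set R := [set t | 0 <= t <= T].

Lemma mfg_u_has_deriv u m i t : mfg_C1_solution L f g T m0 u m -> I t ->
  has_deriv I (fun s => u s 0 i) t
    (- hamiltonian L (nbr_diff E (u t) i) (m t) - f i (m t)).
Proof.
move=> [[Cu _] _ HJ _ _] It.
have := @C1_coord_has_deriv R N T t u i T_gt0 It Cu.
by congr has_deriv; have := HJ i t It; rewrite -/I; lra.
Qed.

Lemma mfg_m_has_deriv u m i t : mfg_C1_solution L f g T m0 u m -> I t ->
  has_deriv I (fun s => m s 0 i) t
    (\sum_(j | E j i) dH_dp L i (nbr_diff E (u t) j) (m t) * m t 0 j
     - \sum_(j | E i j) dH_dp L j (nbr_diff E (u t) i) (m t) * m t 0 i).
Proof.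
move=> [[_ Cm] _ _ _ [FP _]] It; rewrite -FP //.
exact: C1_coord_has_deriv.
Qed.

Variables u1 m1 u2 m2 : R -> 'rV[R]_N.
Hypothesis sol1 : mfg_C1_solution L f g T m0 u1 m1.
Hypothesis sol2 : mfg_C1_solution L f g T m0 u2 m2.

Let pairing t := \sum_i (u1 t 0 i - u2 t 0 i) * (m1 t 0 i - m2 t 0 i).

(** What remains of the derivative of the pairing once the payoffs are set
    aside, in the form of [hamiltonian_monotone]. *)
Let interaction t :=
  let v i := nbr_diff E (u1 t) i - nbr_diff E (u2 t) i in
  \sum_i (m1 t 0 i * dotv (gradH L (nbr_diff E (u1 t) i) (m1 t)) (v i)
    - (m1 t - m2 t) 0 i * hamiltonian L (nbr_diff E (u1 t) i) (m1 t))
  - \sum_i (m2 t 0 i * dotv (gradH L (nbr_diff E (u2 t) i) (m2 t)) (v i)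
    - (m1 t - m2 t) 0 i * hamiltonian L (nbr_diff E (u2 t) i) (m2 t)).

Let payoff (h : 'I_N -> 'rV[R]_N -> R) t :=
  \sum_i (h i (m1 t) - h i (m2 t)) * (m1 t 0 i - m2 t 0 i).

Let pairing_deriv t : I t ->
  has_deriv I pairing t (interaction t - payoff f t).
Proof.
move=> It.
pose q1 i := nbr_diff E (u1 t) i; pose q2 i := nbr_diff E (u2 t) i.
pose w := u1 t - u2 t.
pose tr u m i := \sum_(j | E j i) dH_dp L i (nbr_diff E (u t) j) (m t) * m t 0 j
     - \sum_(j | E i j) dH_dp L j (nbr_diff E (u t) i) (m t) * m t 0 i.
have H : has_deriv I pairing t (\sum_i
   ((- hamiltonian L (q1 i) (m1 t) - f i (m1 t)
     - (- hamiltonian L (q2 i) (m2 t) - f i (m2 t)))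
       * (m1 t 0 i - m2 t 0 i)
    + (u1 t 0 i - u2 t 0 i) * (tr u1 m1 i - tr u2 m2 i))).
  apply: has_deriv_sum => i; apply: has_derivM.
    by apply: has_derivB; apply: mfg_u_has_deriv.
  by apply: has_derivB; apply: mfg_m_has_deriv.
move: H; congr has_deriv.
have e1 := transport_pairing L q1 (m1 t) w.
have e2 := transport_pairing L q2 (m2 t) w.
have ev i : nbr_diff E w i = q1 i - q2 i.
  by apply/rowP => k; rewrite !mxE; ring.
rewrite /interaction /payoff -/w.
rewrite big_split /= !sumrB.
transitivity (\sum_i (- hamiltonian L (q1 i) (m1 t) - f i (m1 t)
     - (- hamiltonian L (q2 i) (m2 t) - f i (m2 t)))
       * (m1 t 0 i - m2 t 0 i) +
  (\sum_i w 0 i * tr u1 m1 i - \sum_i w 0 i * tr u2 m2 i)).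
  congr (_ + _); rewrite -sumrB; apply: eq_bigr => i _.
  by rewrite -mulrBr !mxE.
rewrite e1 e2.
under [\sum_i m1 t 0 i * _]eq_bigr do rewrite ev.
under [\sum_i m2 t 0 i * _]eq_bigr do rewrite ev.
rewrite -!sumrB -!big_split /= -?sumrB; apply: eq_bigr => i _.
rewrite !mxE /q1 /q2; ring.
Qed.

Hypothesis f_mono : strictly_decreasing_on_simplex f.
Hypothesis g_mono : strictly_decreasing_on_simplex g.
Hypothesis interaction_ge0 : forall t, I t -> 0 <= interaction t.

Let m1_simplex t : I t -> simplex (m1 t).
Proof. by case: sol1 => _ + _ _ _; apply. Qed.

Let m2_simplex t : I t -> simplex (m2 t).
Proof. by case: sol2 => _ + _ _ _; apply. Qed.

(** The pairing is nondecreasing and starts from 0. At time [T] it is the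
    pairing of [g], nonpositive unless the distributions agree there; hence it is 0
    throughout, and its derivative is a sum of two nonnegative terms. *)
Lemma mfg_distributions_eq t : I t -> m1 t = m2 t.
Proof.
have I0 : I 0 by rewrite /I /= lexx ltW.
have IT : I T by rewrite /I /= lexx ltW.
have d_ge0 s : I s -> 0 <= interaction s - payoff f s.
  move=> Is; rewrite subr_ge0; apply: le_trans (interaction_ge0 Is).
  exact: strictly_decreasing_le0 f_mono (m1_simplex Is) (m2_simplex Is).
have incr a b : 0 <= a -> a <= b -> b <= T -> pairing a <= pairing b.
  move=> a0 ab bT.
  have sub : [set y | a <= y <= b] `<=` I.
    by move=> y /= /andP[ay yb]; apply/andP; split; lra.
  apply: (has_deriv_ge0_le ab) => s /sub Is; last exact: d_ge0 Is.
  exact: is_derive_within_sub sub (pairing_deriv Is).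
have p0 : pairing 0 = 0.
  rewrite /pairing big1 // => i _.
  by case: sol1 => _ _ _ _ [_ ->]; case: sol2 => _ _ _ _ [_ ->]; rewrite subrr mulr0.
have pT : pairing T = payoff g T.
  apply: eq_bigr => i _.
  by case: sol1 => _ _ _ -> _; case: sol2 => _ _ _ -> _.
have mT : m1 T = m2 T.
  apply: g_mono (m1_simplex IT) (m2_simplex IT) _.
  by rewrite -/(payoff g T) -pT -p0; apply: incr; rewrite // ltW.
have pT0 : pairing T = 0.
  by rewrite /pairing mT big1 // => i _; rewrite subrr mulr0.
have p_eq0 s : I s -> pairing s = 0.
  move=> /andP[s0 sT]; apply/le_anti/andP; split.
    by rewrite -pT0; exact: incr.
  by rewrite -p0; exact: incr.
move=> It; apply: f_mono (m1_simplex It) (m2_simplex It) _.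
suff e : interaction t - payoff f t = 0.
  by rewrite -/(payoff f t); have := interaction_ge0 It; lra.
have PF := itv_steps_proper T_gt0 It.
have <- := derive_withinE PF (pairing_deriv It).
apply: derive_withinE.
apply: cvg_trans (has_deriv_cst I 0 t); apply: near_eq_cvg.
rewrite near_withinE; near=> h => Ih.
by rewrite /= !p_eq0.
Unshelve. all: by end_near. Qed.
End Solutions.

(** * Equality of the value functions *)

(** The function [expR (K * t) * Z t] is nondecreasing and vanishes at [T]. *)
Lemma gronwall_backward (R : realType) (T K : R) (Z dZ : R -> R) :
  (forall t, 0 <= t <= T -> has_deriv [set s | 0 <= s <= T] Z t (dZ t)) ->
  (forall t, 0 <= t <= T -> - (K * Z t) <= dZ t) ->
  Z T = 0 -> forall t, 0 <= t <= T -> Z t <= 0.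
Proof.
move=> HZ Hd ZT t /andP[t0 tT].
have : expR (K * t) * Z t <= expR (K * T) * Z T.
  apply: (has_deriv_ge0_le (phi := fun s => expR (K * s) * Z s)
    (d := fun s => K * expR (K * s) * Z s + expR (K * s) * dZ s)) => // s.
    move=> Ist; have Is : 0 <= s <= T by move: Ist => /andP[? ?]; lra.
    have sub : [set y | t <= y <= T] `<=` [set y | 0 <= y <= T].
      by move=> y /= /andP[? ?]; lra.
    apply: is_derive_within_sub sub _.
    exact: has_derivM (@has_deriv_expR _ _ _ _) (HZ s Is).
  move=> Ist; have Is : 0 <= s <= T by move: Ist => /andP[? ?]; lra.
  have := Hd s Is; rewrite -subr_ge0 opprK => h.
  rewrite [X in 0 <= X](_ : _ = expR (K * s) * (dZ s + K * Z s)); last by ring.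
  by rewrite mulr_ge0 // expR_ge0.
by rewrite ZT mulr0 pmulr_rle0 // expR_gt0.
Qed.

(** A convex function is Lipschitz between two points with the bound of its
    subgradients there. *)
Lemma abs_hamiltonian_le (R : realType) (N : nat) (E : rel 'I_N)
    (L : cost R E) (i : 'I_N) (p p' : 'rV[R]_(outdeg E i)) (mu : 'rV[R]_N)
    (C : R) :
  (forall q q' : 'rV[R]_(outdeg E i),
    dotv (gradH L q mu) (q' - q) <= hamiltonian L q' mu - hamiltonian L q mu) ->
  (forall k, `|gradH L p mu 0 k| <= C) -> (forall k, `|gradH L p' mu 0 k| <= C) ->
  `|hamiltonian L p mu - hamiltonian L p' mu| <=
    C * \sum_k `|p 0 k - p' 0 k|.
Proof.
move=> sub gC gC'.
have bound (x y : 'rV[R]_(outdeg E i)) : (forall k, `|x 0 k| <= C) ->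
    `|dotv x y| <= C * \sum_k `|y 0 k|.
  move=> xC; rewrite mulr_sumr; apply: (le_trans (ler_norm_sum _ _ _)).
  by apply: ler_sum => k _; rewrite normrM ler_wpM2r.
have := bound _ (p' - p) gC; have := bound _ (p - p') gC'.
under eq_bigr do rewrite !mxE.
under [X in _ -> _ <= _ * X -> _]eq_bigr do rewrite !mxE distrC.
move=> /ler_normlP[h1 _] /ler_normlP[h2 _].
have := sub p p'; have := sub p' p => h3 h4.
by rewrite ler_norml; apply/andP; split; lra.
Qed.

Section Values.
Variables (R : realType) (T : R) (N : nat) (E : rel 'I_N) (L : cost R E).
Variables (f g : 'I_N -> 'rV[R]_N -> R) (m0 : 'rV[R]_N).
Hypothesis T_gt0 : 0 < T.
Hypothesis dH_C1 : forall i j, j \in nbrs E i ->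
  C1_on [set z : 'rV[R]_(outdeg E i) * 'rV[R]_N | orthant z.2]
        (fun z => dH_dp L j z.1 z.2).
Hypothesis subgradient : forall i (p p' : 'rV[R]_(outdeg E i)) mu,
  orthant mu ->
  dotv (gradH L p mu) (p' - p) <= hamiltonian L p' mu - hamiltonian L p mu.
Let I : set R := [set t | 0 <= t <= T].

Lemma gradH_along_cvg u m i (k : 'I_(outdeg E i)) t :
  mfg_C1_solution L f g T m0 u m -> I t ->
  gradH L (nbr_diff E (u s) i) (m s) 0 k @[s --> within I (nbhs t)] -->
  gradH L (nbr_diff E (u t) i) (m t) 0 k.
Proof.
move=> [[Cu Cm] simp _ _ _] It.
have FI : Filter (within I (nbhs t)) by exact: within_filter.
have uc := C1_within_cvg It Cu; have mc := C1_within_cvg It Cm.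
have qc : nbr_diff E (u s) i @[s --> within I (nbhs t)] -->
    nbr_diff E (u t) i.
  have uj j : u s 0 j @[s --> within I (nbhs t)] --> u t 0 j.
    exact: cvg_comp _ _ uc (@coord_continuous R 1 N 0 j _).
  apply: cvg_row => j; rewrite mxE; under eq_cvg do rewrite mxE.
  exact: cvgB.
have zc := cvg_pair qc mc.
have kn : nbr k \in nbrs E i by exact: enum_valP.
have [dF [HdF _]] := @dH_C1 i _ kn.
have ot s : I s -> orthant (m s) by move=> /simp[].
have Fc := diff_within_cvg (HdF (nbr_diff E (u t) i, m t) (ot _ It)).
rewrite mxE; under eq_cvg do rewrite mxE.
move=> A /Fc /zc; rewrite /nbhs /= /within /nbhs /=.
by apply: filterS => s H Is; apply: H => //; exact: ot.
Qed.

Variables u1 m1 u2 m2 : R -> 'rV[R]_N.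
Hypothesis sol1 : mfg_C1_solution L f g T m0 u1 m1.
Hypothesis sol2 : mfg_C1_solution L f g T m0 u2 m2.
Hypothesis m_eq : forall t, I t -> m1 t = m2 t.

(** The gradients are continuous along the trajectories; summing all their
    absolute values leaves one function to maximize over [[0, T]]. *)
Let gradient_bound : exists C : R, forall i (k : 'I_(outdeg E i)) t, I t ->
  `|gradH L (nbr_diff E (u1 t) i) (m1 t) 0 k| <= C /\
  `|gradH L (nbr_diff E (u2 t) i) (m2 t) 0 k| <= C.
Proof.
pose G s := \sum_i \sum_(k < outdeg E i)
  (`|gradH L (nbr_diff E (u1 s) i) (m1 s) 0 k| +
   `|gradH L (nbr_diff E (u2 s) i) (m2 s) 0 k|).
have Gc : {within I, continuous G}.
  apply/subspace_continuousP => t It.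
  have FI : Filter (within I (nbhs t)) by exact: within_filter.
  apply: cvg_sum_ord => i; apply: cvg_sum_ord => k.
  by apply: cvgD; apply: cvg_norm; exact: gradH_along_cvg.
have Ic : compact I.
  rewrite (_ : I = `[0, T]%classic); first exact: segment_compact.
  by apply/seteqP; split=> y; rewrite /= in_itv.
have I0 : I !=set0 by exists 0; rewrite /I /= lexx ltW.
have [c _ Hc] := compact_EVT_max I0 Ic Gc.
exists (G c) => i k t It.
have {}Hc : G t <= G c by apply: Hc; rewrite inE.
suff h : `|gradH L (nbr_diff E (u1 t) i) (m1 t) 0 k| +
         `|gradH L (nbr_diff E (u2 t) i) (m2 t) 0 k| <= G t.
  have := normr_ge0 (gradH L (nbr_diff E (u1 t) i) (m1 t) 0 k).
  have := normr_ge0 (gradH L (nbr_diff E (u2 t) i) (m2 t) 0 k).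
  by split; lra.
rewrite /G (bigD1 i) //= (bigD1 k) //= -addrA lerDl.
by rewrite addr_ge0 // sumr_ge0 // => j _; rewrite ?sumr_ge0 // => *; rewrite addr_ge0.
Qed.

(** Gronwall's inequality for [Z = \sum_i w i ^ 2]. The Lipschitz bound gives
    [|w i * dw i| <= C' * \sum_k |w i| * |w (nbr k) - w i|], and each product is
    at most [3 * Z]; with the factor 2 of the derivative of a square this makes
    the constant [K]. *)
Lemma mfg_values_eq t : I t -> u1 t = u2 t.
Proof.
move=> It; have [C HC] := gradient_bound.
pose w s i := u1 s 0 i - u2 s 0 i.
pose q (u : R -> 'rV[R]_N) s i := nbr_diff E (u s) i.
pose dw s i := hamiltonian L (q u2 s i) (m1 s) - hamiltonian L (q u1 s i) (m1 s).
pose Z s := \sum_i w s i * w s i.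
pose dZ s := \sum_i (dw s i * w s i + w s i * dw s i).
pose C' := Num.max C 0.
pose K := \sum_(i < N) 6 * C' * (outdeg E i)%:R.
have C'0 : 0 <= C' by rewrite le_max lexx orbT.
have Z0 s i : w s i * w s i <= Z s.
  by rewrite /Z (bigD1 i) //= lerDl sumr_ge0 // => j _; rewrite -expr2 sqr_ge0.
have HZ s : I s -> has_deriv I Z s (dZ s).
  move=> Is.
  have dwi i : has_deriv I (fun s => w s i) s (dw s i).
    have := has_derivB (@mfg_u_has_deriv R T N E L f g m0 T_gt0 u1 m1 i s sol1 Is)
      (@mfg_u_has_deriv R T N E L f g m0 T_gt0 u2 m2 i s sol2 Is).
    by congr has_deriv; rewrite /dw /q m_eq //; ring.
  by apply: has_deriv_sum => i; exact: has_derivM.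
have dwC s i : I s -> `|dw s i| <= C' * \sum_(k < outdeg E i) `|w s (nbr k) - w s i|.
  move=> Is.
  have om : orthant (m1 s) by case: sol1 => _ + _ _ _ => /(_ s Is) [].
  have CC' : C <= C' by rewrite le_max lexx.
  have gC2 k : `|gradH L (q u2 s i) (m1 s) 0 k| <= C'.
    by apply: le_trans CC'; rewrite m_eq //; exact: (HC i k s Is).2.
  have gC1 k : `|gradH L (q u1 s i) (m1 s) 0 k| <= C'.
    by apply: le_trans CC'; exact: (HC i k s Is).1.
  apply: (le_trans (abs_hamiltonian_le
    (fun p p' => @subgradient i p p' _ om) gC2 gC1)).
  rewrite ler_wpM2l //; apply: ler_sum => k _; rewrite !mxE /w distrC.
  set a := (X in `|X| <= _); set b := (X in _ <= `|X|).
  by rewrite (_ : a = b) // /a /b; ring.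
have dZC s : I s -> - (K * Z s) <= dZ s.
  move=> Is; rewrite /K mulr_suml -sumrN; apply: ler_sum => i _.
  have h : `|w s i * dw s i| <= 3 * C' * (outdeg E i)%:R * Z s.
    rewrite normrM; apply: (le_trans (ler_wpM2l _ (dwC s i Is))) => //.
    set S := \sum_(k < _) _.
    have -> : `|w s i| * (C' * S) = C' * (`|w s i| * S) by ring.
    have -> : 3 * C' * (outdeg E i)%:R * Z s = C' * ((outdeg E i)%:R * (3 * Z s)).
      by ring.
    rewrite ler_wpM2l // mulr_sumr mulr_natl -[X in _ *+ X]card_ord -sumr_const.
    apply: ler_sum => k _; rewrite -normrM.
    have := Z0 s i; have := Z0 s (nbr k).
    move: (w s i) (w s (nbr k)) => a b ha hb.
    by rewrite ler_norml; apply/andP; split; nra.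
  move: h => /ler_normlP[h _]; lra.
have ZT : Z T = 0.
  rewrite /Z big1 // => i _; rewrite /w.
  case: sol1 => _ _ _ -> _; case: sol2 => _ _ _ -> _.
  by rewrite m_eq ?subrr ?mul0r // /I /= lexx ltW.
have Zt := gronwall_backward HZ dZC ZT It.
apply/rowP => i; apply/eqP; rewrite -subr_eq0 -sqrf_eq0; apply/eqP/le_anti.
by rewrite sqr_ge0 andbT expr2; exact: le_trans (Z0 t i) Zt.
Qed.
End Values.

Theorem theorem2 (R : realType) (T : R) (N : nat) (E : rel 'I_N)
    (L : forall i : 'I_N, 'rV[R]_(outdeg E i) -> 'rV[R]_N -> R)
    (f g : 'I_N -> 'rV[R]_N -> R)
    (T_gt0 : 0 < T)
    (E_irrefl : forall i, ~~ E i i)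
    (L_ge0 : forall i lam mu, orthant lam -> orthant mu -> 0 <= L i lam mu)
    (L_cont : forall i,
       {within [set z : 'rV[R]_(outdeg E i) * 'rV[R]_N
                 | orthant z.1 /\ orthant z.2],
         continuous (fun z => L i z.1 z.2)})
    (f_cont : forall i, {within @orthant R N, continuous (f i)})
    (g_cont : forall i, {within @orthant R N, continuous (g i)})
    (L_convex : forall i mu, orthant mu ->
       strictly_convex_on_orthant (fun lam => L i lam mu))
    (L_superlinear : forall i, superlinear (L i))
    (g_mono : strictly_decreasing_on_simplex g)
    (f_mono : strictly_decreasing_on_simplex f)
    (H_diff : forall i (p : 'rV[R]_(outdeg E i)) (mu : 'rV[R]_N),
       orthant mu ->
       differentiable_within (@orthant R N) (fun nu => hamiltonian L p nu) mu)
    (dH_C1 : forall i j, j \in nbrs E i ->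
       C1_on [set z : 'rV[R]_(outdeg E i) * 'rV[R]_N | orthant z.2]
             (fun z => dH_dp L j z.1 z.2))
    (M_pos : forall (q : forall i, 'rV[R]_(outdeg E i)) (mu : 'rV[R]_N),
       simplex mu -> positive_mx (mxM L q mu))
    (m0 : 'rV[R]_N) (m0_simplex : simplex m0)
    (u1 m1 u2 m2 : R -> 'rV[R]_N)
    (sol1 : mfg_C1_solution L f g T m0 u1 m1)
    (sol2 : mfg_C1_solution L f g T m0 u2 m2) :
  (forall t, 0 <= t <= T -> m1 t = m2 t) /\
  (forall t, 0 <= t <= T -> u1 t = u2 t).
Proof.
have sub := hamiltonian_subgradient L_ge0 L_cont L_convex L_superlinear.
have m_eq t : 0 <= t <= T -> m1 t = m2 t.
  move=> It; apply: (mfg_distributions_eq T_gt0 sol1 sol2 f_mono g_mono) It.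
  move=> s Is; rewrite subr_ge0.
  apply: (hamiltonian_monotone L_ge0 L_cont L_convex L_superlinear H_diff dH_C1
    M_pos).
  - by case: sol1 => _ + _ _ _; apply.
  - by case: sol2 => _ + _ _ _; apply.
split=> // t It.
exact: (mfg_values_eq T_gt0 dH_C1 sub sol1 sol2 m_eq).
Qed.
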